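(* Let $f\in C^{1,1}(B_{10}\times\mathbb{R})$ be a positive function and let $u\in C^4(B_{10})$ be a convex solution of $$F(D^2u)=\left(\frac{\sigma_3}{\sigma_1}\right)(D^2u)=f(x,u)\quad\text{in } B_{10}\subset\mathbb{R}^3 .$$ Let $M$ be a large constant satisfying $\|u\|_{L^\infty(\overline{B}_9)}\leq M$. Then there exist a large constant $\Lambda(f)$ depending only on $\max_{\overline{B}_9\times[-M,M]}f$, and a constant $C$ depending only on $\|u\|_{C^{0,1}(\overline{B}_9)}$, $\min_{\overline{B}_9\times[-M,M]}f$ and $\|f\|_{C^{1,1}(\overline{B}_9\times[-M,M])}$, such that the following holds. For any $x_0\in B_9$, suppose that coordinates are chosen so that $D^2u$ is diagonalized at $x_0$ with $\lambda_1\geq\lambda_2\geq\lambda_3$, and that $\lambda_1\geq\Lambda(f)$ at $x_0$. Set $b=\ln\lambda_1$. Then at $x_0$, $$\sum_i F^{ii}b_{ii}\geq\frac{1}{432}\sum_i F^{ii}b_i^2-C$$ in the viscosity sense.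
   Context: $B_r$ denotes the open ball of radius $r$ centered at the origin in $\mathbb{R}^3$. $\sigma_k(A)$ is the $k$-th elementary symmetric function of the eigenvalues of a symmetric $3\times3$ matrix $A$, and $F(A)=\sigma_3(A)/\sigma_1(A)$. $\lambda_1\geq\lambda_2\geq\lambda_3$ are the eigenvalues of $D^2u$ at each point ($\lambda_1=\lambda_1(D^2u(x))$ is regarded as a function of $x$). $F^{ij}=\frac{\partial F}{\partial u_{ij}}(D^2u)$; where $D^2u$ is diagonal, $F^{ii}=\frac{\sigma_3^{ii}}{\sigma_1}-\frac{\sigma_3}{\sigma_1^2}$ with $\sigma_3^{ii}=\partial\sigma_3/\partial u_{ii}$. Subscripts on $b$ denote partial derivatives. The inequality at $x_0$ holding in the viscosity sense is meant in the standard (subsolution) sense: for every $C^2$ function $\varphi$ defined near $x_0$ with $\varphi\geq b$ near $x_0$ and $\varphi(x_0)=b(x_0)$, one has $\sum_i F^{ii}\varphi_{ii}\geq\frac{1}{432}\sum_i F^{ii}\varphi_i^2-C$ at $x_0$. *)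

(* Defs.v *)
From HB Require Import structures.
From mathcomp Require Export all_boot all_order all_algebra.
From mathcomp Require Export all_classical all_reals all_analysis.
Export numFieldNormedType.Exports.

Set Implicit Arguments.
Unset Strict Implicit.
Unset Printing Implicit Defensive.

Import Order.TTheory GRing.Theory Num.Theory.
Local Open Scope classical_set_scope.
Local Open Scope ring_scope.

(* The library norm on row vectors is the sup norm. *)
Definition enorm (R : realType) (n : nat) (x : 'rV[R]_n) : R :=
  Num.sqrt (\sum_i x 0 i ^+ 2).

Definition eball (R : realType) (n : nat) (r : R) : set 'rV[R]_n :=
  [set x | enorm x < r].

Definition ecball (R : realType) (n : nat) (r : R) : set 'rV[R]_n :=
  [set x | enorm x <= r].

(* The rows of an orthogonal matrix Q are the axes of a Cartesian coordinate
   system; derivatives below are taken in these coordinates, and Q = 1%:M gives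
   the standard ones. *)
Definition partial (R : realType) (n : nat) (Q : 'M[R]_n) (i : 'I_n)
    (g : 'rV[R]_n -> R) : 'rV[R]_n -> R :=
  'D_(row i Q) g.

Definition grad (R : realType) (n : nat) (Q : 'M[R]_n)
    (g : 'rV[R]_n -> R) (x : 'rV[R]_n) : 'rV[R]_n :=
  \row_i partial Q i g x.

Definition hess (R : realType) (n : nat) (Q : 'M[R]_n)
    (g : 'rV[R]_n -> R) (x : 'rV[R]_n) : 'M[R]_n :=
  \matrix_(i, j) partial Q j (partial Q i g) x.

Fixpoint Ck (R : realType) (n k : nat) (U : set 'rV[R]_n)
    (g : 'rV[R]_n -> R) : Prop :=
  (forall x, U x -> {for x, continuous g}) /\
  match k with
  | 0%N => True
  | k'.+1 => forall i : 'I_n,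
      (forall x, U x -> derivable g x (row i 1%:M)) /\
      Ck k' U (partial 1%:M i g)
  end.

(* On an open set, C^{1,1} is understood locally; the norm [normC11] below is
   used on compact convex subsets, where it is finite. *)
Definition C11 (R : realType) (n : nat) (U : set 'rV[R]_n)
    (g : 'rV[R]_n -> R) : Prop :=
  Ck 1 U g /\
  forall (i : 'I_n) p, U p ->
    exists2 W, nbhs p W & [lipschitz partial 1%:M i g q | q in W].

Definition supnorm (R : realType) (n : nat) (K : set 'rV[R]_n)
    (g : 'rV[R]_n -> R) : R :=
  sup [set `|g x| | x in K].

(* d x y is the distance between the values at x and y of the function whose
   Lipschitz seminorm on K is taken. *)
Definition lipnorm (R : realType) (n : nat) (K : set 'rV[R]_n)
    (d : 'rV[R]_n -> 'rV[R]_n -> R) : R :=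
  sup [set z | exists x y,
    [/\ K x, K y, x != y & z = d x y / enorm (x - y)]].

Definition normC01 (R : realType) (n : nat) (K : set 'rV[R]_n)
    (g : 'rV[R]_n -> R) : R :=
  supnorm K g + lipnorm K (fun x y => `|g x - g y|).

Definition normC11 (R : realType) (n : nat) (K : set 'rV[R]_n)
    (g : 'rV[R]_n -> R) : R :=
  supnorm K g + supnorm K (fun x => enorm (grad 1%:M g x))
  + lipnorm K (fun x y => enorm (grad 1%:M g x - grad 1%:M g y)).

(* A function of (x, t) seen as a function on R^(n+1). *)
Definition joint (R : realType) (n : nat) (f : 'rV[R]_n -> R -> R)
    (p : 'rV[R]_(n + 1)) : R :=
  f (lsubmx p) (rsubmx p 0 0).

Definition cyl (R : realType) (n : nat) (A : set 'rV[R]_n) (I : set R) :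
    set 'rV[R]_(n + 1) :=
  [set p | A (lsubmx p) /\ I (rsubmx p 0 0)].

(* The real eigenvalues with multiplicity, in decreasing order; they exist and
   are unique when A is symmetric. *)
Definition eigenvalues (R : realType) (n : nat) (A : 'M[R]_n) : seq R :=
  xget [::] [set s : seq R |
    sorted >=%R s /\ char_poly A = \prod_(a <- s) ('X - a%:P)].

(* Indexed from 0: the largest eigenvalue is [lambda 0 A]. *)
Definition lambda (R : realType) (n : nat) (i : nat) (A : 'M[R]_n) : R :=
  (eigenvalues A)`_i.

Definition sigma (R : realType) (n : nat) (k : nat) (A : 'M[R]_n) : R :=
  \sum_(I : {set 'I_n} | #|I| == k) \prod_(i in I) lambda i A.

Definition F (R : realType) (A : 'M[R]_3) : R := sigma 3 A / sigma 1 A.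

(* The partial derivative of F with respect to the i-th diagonal entry. *)
Definition Fdiag (R : realType) (A : 'M[R]_3) (i : 'I_3) : R :=
  'D_(delta_mx i i) (@F R) A.

Definition touches_above (R : realType) (n : nat)
    (phi b : 'rV[R]_n -> R) (x0 : 'rV[R]_n) : Prop :=
  [/\ exists V : set 'rV[R]_n, [/\ open V, V x0 & Ck 2 V phi],
      \forall x \near x0, b x <= phi x
    & phi x0 = b x0].

(* Main.v *)
Require Import Defs.
From mathcomp Require Import spectral complex sesquilinear ring lra.

(** Why the inequality holds.  Let e1, e2, e3 be the axes at x0, write u_11 for
the second derivative of u along e1, and g(x) = f(x, u(x)).

The largest eigenvalue dominates the Rayleigh quotient of e1, so
ln u_11 <= ln lambda_1 near x0, with equality at x0 ([rayleigh]).  A test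
function phi above b = ln lambda_1 is therefore above the C^2 function ln u_11,
whatever the multiplicity of lambda_1, and the one-variable second-derivative
test along each axis ([touches_above_ln]) gives
phi_i = u_11i / lambda_1 and phi_ii >= u_11ii / lambda_1 - (u_11i / lambda_1)^2.

Near x0 the equation reads det D^2u = g tr D^2u.  Differentiating it once and
twice along e1 ([differentiated_equation]) gives a linear relation between
u_111, u_221, u_331 and expresses sum_i F^ii u_11ii through g_11, g_1 and the
third derivatives of u.  In [jacobi_algebra] the off-diagonal terms have a good
sign: u_112^2 comes with the factor 2 lambda_3 / sigma_1, and
F^22 / lambda_1 <= lambda_3 / sigma_1, which pays for the term
(1 + 1/432) F^22 (u_112 / lambda_1)^2; likewise for u_113, and u_123^2 comes with
a positive factor.  What remains is a quadratic form in u_111 / lambda_1,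
u_221 / lambda_2, u_331 / lambda_3, and on the plane cut out by the once
differentiated equation it is bounded below by -4 (g_1 / g)^2
([log_eigenvalue_form_ge]).  Hence the left-hand side minus 1/432 of the
gradient term is at least g_11 / lambda_1 - 5 g_1^2 / (g lambda_1).

Finally g_1 is bounded by the norms of f and u, and g_11 is bounded below by
-C (1 + lambda_1): the gradient of f is only Lipschitz, but g_11 exists because
g = det / tr is C^2, and it can be estimated from difference quotients of
f_1 + f_t u_1 ([rhs_derive_le], [rhs_derive2_ge]).  Dividing by lambda_1 >= 1
leaves a constant, so that Lambda = 1 suffices.

The norms are suprema that would be zero on unbounded sets; compactness of the
balls and cylinders makes them genuine bounds.  Derivatives are directional
limits, and the passage to rotated axes rests on their linearity in the
direction ([C1_is_derive]) and on the symmetry of second derivatives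
([derive_comm]). *)

Set Implicit Arguments.
Unset Strict Implicit.
Unset Printing Implicit Defensive.

Import Order.TTheory GRing.Theory Num.Theory.
Local Open Scope classical_set_scope.
Local Open Scope ring_scope.

(** * Eigenvalues of real symmetric matrices *)

Lemma char_poly_similar (K : fieldType) n (P D : 'M[K]_n) :
  P \in unitmx -> char_poly (invmx P *m D *m P) = char_poly D.
Proof.
move=> Pu; rewrite /char_poly /char_poly_mx.
have PV : map_mx polyC (invmx P) *m map_mx polyC P = 1%:M.
  by rewrite -map_mxM mulVmx // map_mx1.
have -> : 'X%:M - map_mx polyC (invmx P *m D *m P)
    = map_mx polyC (invmx P) *m ('X%:M - map_mx polyC D) *m map_mx polyC P.
  rewrite mulmxBr mulmxBl !map_mxM /=; congr (_ - _).
  by rewrite mul_mx_scalar -scalemxAl PV scalemx1.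
by rewrite !det_mulmx mulrAC -det_mulmx PV det1 mul1r.
Qed.

Section real_spectral.
Local Open Scope sesquilinear_scope.

(** The spectral theorem over the complex numbers, transported to a real matrix:
the eigenvalues of a Hermitian matrix are real.  The weights m are the squared
moduli of the coordinates of v in a unitary eigenbasis, so that no real
eigenbasis has to be constructed. *)
Lemma real_spectral (R : realType) n (A : 'M[R]_n) : A^T = A ->
  exists D : 'rV[R]_n,
    char_poly A = \prod_i ('X - (D 0 i)%:P) /\
    forall v : 'rV[R]_n, exists m : 'I_n -> R,
      [/\ forall i, 0 <= m i,
          (v *m A *m v^T) 0 0 = \sum_i D 0 i * m i
        & (v *m v^T) 0 0 = \sum_i m i].
Proof.
move=> Asym; pose C := R[i]; pose r := real_complex R.
pose A' : 'M[C]_n := map_mx r A.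
have rconj x : Num.conj (r x) = r x.
  by rewrite /r; apply/CrealP; rewrite complex_real.
have rinj : injective r by exact: complexI.
have rsum (G : 'I_n -> R) : r (\sum_i G i) = \sum_i r (G i) by exact: rmorph_sum.
have rM x y : r (x * y) = r x * r y by exact: rmorphM.
have A'h : A' \is hermsymmx.
  apply: realsym_hermsym.
    apply/is_hermitianmxP; rewrite expr0 scale1r map_mx_id //.
    by rewrite /A' map_trmx Asym.
  by apply/mxOverP => i j; rewrite mxE complex_real.
have dr := hermitian_spectral_diag_real A'h.
have /orthomx_spectralP := hermitian_normalmx A'h.
have Pu := spectral_unitarymx A'.
move: dr Pu; set d := spectral_diag A'; set P := spectralmx A' => dr Pu A'E.
pose D : 'rV[R]_n := \row_i complex.Re (d 0 i).
have dE i : d 0 i = r (D 0 i).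
  by rewrite /D mxE /r RRe_real //; exact: (mxOverP dr).
exists D; split.
  apply: (map_poly_inj r); rewrite map_char_poly -/A' A'E.
  rewrite char_poly_similar ?unitarymx_unit // char_poly_trig; last first.
    by apply/is_trig_mxP => i j ij; rewrite mxE -(inj_eq val_inj) /= ltn_eqF.
  rewrite rmorph_prod; apply: eq_bigr => i _.
  by rewrite rmorphB /= map_polyX map_polyC /= mxE eqxx mulr1n dE.
move=> v; pose v' := map_mx r v; pose w := v' *m P^t*.
exists (fun i => complex.Re (w 0 i * (w 0 i)^*)).
have wr i : r (complex.Re (w 0 i * (w 0 i)^*)) = w 0 i * (w 0 i)^*.
  by rewrite /r RRe_real // ger0_real // mul_conjC_ge0.
have wt : P *m v'^T = w^t*.
  rewrite /w trmx_mul map_mxM trmxCK; congr (_ *m _).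
  by apply/matrixP => i j; rewrite !mxE; exact: (esym (rconj _)).
have wtE i : (w^t*) i 0 = (w 0 i)^* by rewrite 2!mxE.
split.
- by move=> i; rewrite -(lecR 0) /= -/r wr mul_conjC_ge0.
- apply: rinj; rewrite rsum.
  have -> : r ((v *m A *m v^T) 0 0) = (v' *m A' *m v'^T) 0 0.
    by rewrite /v' /A' map_trmx -!map_mxM [RHS]mxE.
  rewrite A'E invmx_unitary // !mulmxA -/w -mulmxA wt mul_mx_diag mxE.
  apply: eq_bigr => i _; rewrite rM wr -dE wtE [X in X * _]mxE.
  by rewrite mulrAC mulrC mulrA.
- apply: rinj; rewrite rsum.
  have -> : r ((v *m v^T) 0 0) = (v' *m v'^T) 0 0.
    by rewrite /v' map_trmx -!map_mxM [RHS]mxE.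
  have -> : v' *m v'^T = w *m w^t*.
    by rewrite -wt /w mulmxA mulmxKtV.
  by rewrite mxE; apply: eq_bigr => i _; rewrite wr wtE.
Qed.

End real_spectral.

(** [eigenvalues] is a choice with a default value; the spectral theorem supplies
a list to choose. *)
Lemma eigenvaluesP (R : realType) n (A : 'M[R]_n) : A^T = A ->
  sorted >=%R (eigenvalues A) /\
  char_poly A = \prod_(a <- eigenvalues A) ('X - a%:P).
Proof.
move=> Asym; have [D [cA _]] := real_spectral Asym.
rewrite /eigenvalues; case: xgetP => [s _ //|/(_ (sort >=%R (codom (D 0)))) []].
split; first by apply: sort_sorted => x y; exact: le_total.
by rewrite cA (perm_big _ (permEl (perm_sort _ _))) /= big_image.
Qed.

Lemma size_eigenvalues (R : realType) n (A : 'M[R]_n) : A^T = A ->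
  size (eigenvalues A) = n.
Proof.
move=> /eigenvaluesP[_ cA]; have := size_char_poly A.
by rewrite cA size_prod_XsubC => -[].
Qed.

(** The quadratic form is an average of the eigenvalues with total weight
[v *m v^T], and each of them is at most the first one of the sorted list. *)
Lemma rayleigh (R : realType) n (A : 'M[R]_n) (v : 'rV[R]_n) : A^T = A ->
  (v *m A *m v^T) 0 0 <= lambda 0 A * (v *m v^T) 0 0.
Proof.
move=> Asym; have [D [cA /(_ v)[m [m0 -> ->]]]] := real_spectral Asym.
rewrite mulr_sumr; apply: ler_sum => i _; apply: ler_wpM2r => //.
have [so cA'] := eigenvaluesP Asym.
have : root (char_poly A) (D 0 i).
  by rewrite cA /root horner_prod (bigD1 i) //= !hornerE subrr mul0r.
rewrite cA' root_prod_XsubC /lambda.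
case: (eigenvalues A) so => //= a s so; rewrite inE => /predU1P[-> //|Ds].
have /(order_path_min ge_trans) := so.
by move/allP; exact.
Qed.

Lemma sigma_top (R : realType) n (A : 'M[R]_n) : A^T = A ->
  sigma n A = \det A.
Proof.
move=> Asym; have [_ cA] := eigenvaluesP Asym.
have sz := size_eigenvalues Asym.
rewrite /sigma (big_pred1 [set: 'I_n]%SET); last first.
  move=> I; rewrite /= eqEcard finset.subsetT cardsT card_ord eqn_leq.
  by rewrite -[X in (_ <= X)%N]card_ord max_card.
have := char_poly_det A; rewrite cA coef0_prod_XsubC sz.
move/(mulrI (unitrX n (unitrN1 R))) => <-.
rewrite (big_nth 0) sz big_mkord; apply: eq_bigl => i; exact: finset.in_setT.
Qed.

Lemma sigma_1 (R : realType) n (A : 'M[R]_n.+1) : A^T = A ->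
  sigma 1 A = \tr A.
Proof.
move=> Asym; have [_ cA] := eigenvaluesP Asym.
have sz := size_eigenvalues Asym.
have sz0 : size (eigenvalues A) != 0%N by rewrite sz.
have := coefPn_prod_XsubC sz0; rewrite -cA {1}sz char_poly_trace //.
move/oppr_inj => ->; rewrite (big_nth 0) sz big_mkord /sigma.
rewrite (reindex (fun i : 'I_n.+1 => [set i]%SET)) /=; last first.
  exists (fun I : {set 'I_n.+1} => odflt ord0 [pick i in I]) => [i _ | I /cards1P[i ->]];
    by case: pickP => [j /finset.set1P -> //|/(_ i)]; rewrite finset.set11.
by apply: eq_big => [i|i _]; rewrite ?cards1 ?eqxx // big_set1.
Qed.

Lemma F_sym (R : realType) (A : 'M[R]_3) : A^T = A -> F A = \det A / \tr A.
Proof. by move=> Asym; rewrite /F sigma_top // sigma_1. Qed.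

Lemma lambda_le (R : realType) n (A : 'M[R]_n) (i j : nat) : A^T = A ->
  (i <= j < n)%N -> lambda j A <= lambda i A.
Proof.
move=> Asym /andP[ij jn]; have [so _] := eigenvaluesP Asym.
have sz := size_eigenvalues Asym.
by apply: (sorted_leq_nth ge_trans ge_refl) => //; rewrite inE sz //;
  apply: leq_ltn_trans jn.
Qed.

(** * The algebraic inequality *)

(** The quadratic form left over by the largest eigenvalue: w_i is
lambda_i / sigma_1, and x, y, z are the derivatives of u_ii along the first axis
divided by lambda_i.  In terms of S = y + z, d = y - z, s = w2 + w3 and
e = w2 - w3, the linear constraint turns the form into a sum of nonnegative terms
minus 4 g^2, because 0 <= e <= s and w2 <= w1 means 3 s <= 2 - e. *)
Lemma log_eigenvalue_form_ge (R : realFieldType) (w1 w2 w3 x y z g : R) :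
  w1 + w2 + w3 = 1 -> w2 <= w1 -> w3 <= w2 -> 0 <= w3 ->
  (1 - w1) * x + (1 - w2) * y + (1 - w3) * z = g ->
  - 4 * g ^+ 2 <= x ^+ 2 + y ^+ 2 + z ^+ 2 - (w1 * x + w2 * y + w3 * z) ^+ 2
    - 433 / 432 * (1 - w1) * x ^+ 2.
Proof.
move=> ws w21 w32 w3_ge0 gE.
pose e := w2 - w3; pose S := y + z; pose d := y - z; pose s := w2 + w3.
have e0 : 0 <= e by rewrite /e; lra.
have es : e <= s by rewrite /e /s; lra.
have e2 : e <= 1 / 2 by rewrite /e; lra.
have se : 3 * s <= 2 - e by rewrite /e /s; lra.
have -> : x ^+ 2 + y ^+ 2 + z ^+ 2 - (w1 * x + w2 * y + w3 * z) ^+ 2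
    - 433 / 432 * (1 - w1) * x ^+ 2
  = (s - e) * (9 / 10) * x ^+ 2 + (431 / 432 - 9 / 10) * s * x ^+ 2
    + 9 / 10 * e * (x - d / (9 / 5)) ^+ 2
    + (S - 3 * e * d) ^+ 2 / 12 + (S + 6 * g) ^+ 2 / 12
    + (1 / 2 - e * (5 / 18) - 3 / 4 * e ^+ 2) * d ^+ 2
    + ((1 - s) / 2 - 1 / 6) * S ^+ 2 - 4 * g ^+ 2.
  have -> : w1 = 1 - s by rewrite /s; lra.
  rewrite -gE; have -> : w1 = 1 - s by rewrite /s; lra.
  by rewrite /e /S /d /s; field.
have x2 := sqr_ge0 x; have d2 := sqr_ge0 d; have S2 := sqr_ge0 S.
have H1 : 0 <= (s - e) * x ^+ 2 by apply: mulr_ge0 => //; lra.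
have H2 : 0 <= s * x ^+ 2 by apply: mulr_ge0 => //; lra.
have H3 := mulr_ge0 e0 (sqr_ge0 (x - d / (9 / 5))).
have H4 := sqr_ge0 (S - 3 * e * d); have H5 := sqr_ge0 (S + 6 * g).
have H6 : 0 <= (1 / 2 - e * (5 / 18) - 3 / 4 * e ^+ 2) * d ^+ 2.
  apply: mulr_ge0 => //.
  have : e ^+ 2 <= 1 / 4 by rewrite expr2; nra.
  lra.
have H7 : 0 <= ((1 - s) / 2 - 1 / 6) * S ^+ 2 by apply: mulr_ge0 => //; lra.
lra.
Qed.

(** The pointwise inequality, with all derivatives replaced by real numbers:
a, b, c stand for u_111, u_221, u_331, then p, q, r for u_112, u_113, u_123, and
a4, b4, c4 for u_1111, u_1122, u_1133; g1, g2 are the first two derivatives of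
the right-hand side along the first axis, and p11, p22, p33 the second
derivatives of the test function. *)
Lemma jacobi_algebra (R : realFieldType)
  (l1 l2 l3 f g1 g2 a b c p q r a4 b4 c4 p11 p22 p33 : R)
  (s := l1 + l2 + l3) (F1 := (l2 * l3 - f) / s) (F2 := (l1 * l3 - f) / s)
  (F3 := (l1 * l2 - f) / s) :
  l2 <= l1 -> l3 <= l2 -> 0 < l3 -> l1 * l2 * l3 = f * s ->
  l2 * l3 * a + l1 * l3 * b + l1 * l2 * c = g1 * s + f * (a + b + c) ->
  l2 * l3 * a4 + l1 * l3 * b4 + l1 * l2 * c4
    + 2 * (l3 * a * b + l2 * a * c + l1 * b * c)
    - 2 * (l3 * p ^+ 2 + l2 * q ^+ 2 + l1 * r ^+ 2)
  = g2 * s + 2 * g1 * (a + b + c) + f * (a4 + b4 + c4) ->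
  a4 / l1 - (a / l1) ^+ 2 <= p11 ->
  b4 / l1 - (p / l1) ^+ 2 <= p22 ->
  c4 / l1 - (q / l1) ^+ 2 <= p33 ->
  g2 / l1 - 5 * (g1 ^+ 2 / (f * l1)) <=
  F1 * p11 + F2 * p22 + F3 * p33
  - 1 / 432 * (F1 * (a / l1) ^+ 2 + F2 * (p / l1) ^+ 2 + F3 * (q / l1) ^+ 2).
Proof.
move=> l21 l32 l3_gt0 fE E1 E2 h11 h22 h33.
have l2_gt0 : 0 < l2 by apply: lt_le_trans l32.
have l1_gt0 : 0 < l1 by apply: lt_le_trans l21.
have s_gt0 : 0 < s by rewrite /s; lra.
have f_gt0 : 0 < f.
  by rewrite -(pmulr_lgt0 _ s_gt0) -fE !mulr_gt0.
have l1n := lt0r_neq0 l1_gt0; have l2n := lt0r_neq0 l2_gt0.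
have l3n := lt0r_neq0 l3_gt0; have sn := lt0r_neq0 s_gt0.
have fn := lt0r_neq0 f_gt0.
have ff : f = l1 * l2 * l3 / s by rewrite fE mulfK.
have F1E : F1 = l2 * l3 * (l2 + l3) / s ^+ 2.
  by rewrite /F1 ff /s; field.
have F2E : F2 = l1 * l3 * (l1 + l3) / s ^+ 2.
  by rewrite /F2 ff /s; field.
have F3E : F3 = l1 * l2 * (l1 + l2) / s ^+ 2.
  by rewrite /F3 ff /s; field.
have F1_ge0 : 0 <= F1 by rewrite F1E divr_ge0 ?mulr_ge0 ?sqr_ge0 ?addr_ge0 ?ltW.
have F2_ge0 : 0 <= F2 by rewrite F2E divr_ge0 ?mulr_ge0 ?sqr_ge0 ?addr_ge0 ?ltW.
have F3_ge0 : 0 <= F3 by rewrite F3E divr_ge0 ?mulr_ge0 ?sqr_ge0 ?addr_ge0 ?ltW.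
have G1 := ler_wpM2l F1_ge0 h11.
have G2 := ler_wpM2l F2_ge0 h22.
have G3 := ler_wpM2l F3_ge0 h33.
(* F_i s = l_j l_k - f, so the fourth derivatives form exactly the combination
   that occurs in the twice differentiated equation. *)
have E2' : F1 * a4 + F2 * b4 + F3 * c4
  = g2 + (2 * g1 * (a + b + c) - 2 * (l3 * a * b + l2 * a * c + l1 * b * c)
    + 2 * (l3 * p ^+ 2 + l2 * q ^+ 2 + l1 * r ^+ 2)) / s.
  have -> : F1 * a4 + F2 * b4 + F3 * c4 =
      (l2 * l3 * a4 + l1 * l3 * b4 + l1 * l2 * c4 - f * (a4 + b4 + c4)) / s.
    by rewrite /F1 /F2 /F3; field.
  have -> : l2 * l3 * a4 + l1 * l3 * b4 + l1 * l2 * c4 - f * (a4 + b4 + c4)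
    = g2 * s + (2 * g1 * (a + b + c) - 2 * (l3 * a * b + l2 * a * c + l1 * b * c)
    + 2 * (l3 * p ^+ 2 + l2 * q ^+ 2 + l1 * r ^+ 2)) by lra.
  by rewrite mulrDl mulfK.
pose x := a / l1; pose y := b / l2; pose z := c / l3.
pose w1 := l1 / s; pose w2 := l2 / s; pose w3 := l3 / s.
have aE : a = l1 * x by rewrite /x; field.
have bE : b = l2 * y by rewrite /y; field.
have cE : c = l3 * z by rewrite /z; field.
have g1E : (1 - w1) * x + (1 - w2) * y + (1 - w3) * z = g1 / f.
  apply: (mulIf (mulf_neq0 fn sn)).
  have -> : g1 / f * (f * s) = g1 * s by field.
  have -> : g1 * s = l2 * l3 * a + l1 * l3 * b + l1 * l2 * c - f * (a + b + c).
    by rewrite E1; ring.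
  by rewrite /w1 /w2 /w3 aE bE cE ff; field.
have w_sum : w1 + w2 + w3 = 1 by rewrite /w1 /w2 /w3 -!mulrDl mulfV.
have w21 : w2 <= w1 by rewrite ler_pM2r ?invr_gt0.
have w32 : w3 <= w2 by rewrite ler_pM2r ?invr_gt0.
have w3_ge0 : 0 <= w3 by rewrite divr_ge0 ?ltW.
have Q := log_eigenvalue_form_ge w_sum w21 w32 w3_ge0 g1E.
have fl_gt0 : 0 <= f / l1 by rewrite divr_ge0 ?ltW.
have Q' := ler_wpM2l fl_gt0 Q.
have g1f : f / l1 * (- 4 * (g1 / f) ^+ 2) = - 4 * (g1 ^+ 2 / (f * l1)).
  by field; rewrite ?fn ?l1n.
have Tot : (F1 * a4 + F2 * b4 + F3 * c4) / l1
    - 433 / 432 * (F1 * (a / l1) ^+ 2 + F2 * (p / l1) ^+ 2 + F3 * (q / l1) ^+ 2)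
  = g2 / l1 - g1 ^+ 2 / (f * l1)
    + f / l1 * (x ^+ 2 + y ^+ 2 + z ^+ 2 - (w1 * x + w2 * y + w3 * z) ^+ 2
    - 433 / 432 * (1 - w1) * x ^+ 2)
    + (2 * (l3 / (l1 * s)) - 433 / 432 * (F2 / l1 ^+ 2)) * p ^+ 2
    + (2 * (l2 / (l1 * s)) - 433 / 432 * (F3 / l1 ^+ 2)) * q ^+ 2
    + 2 / s * r ^+ 2.
  rewrite E2'.
  have -> : g1 = f * ((1 - w1) * x + (1 - w2) * y + (1 - w3) * z).
    by rewrite g1E; field; rewrite ?fn.
  by rewrite /w1 /w2 /w3 aE bE cE F1E F2E F3E ff /s; field; rewrite -/s ?sn ?l1n ?l2n ?l3n.
have P2 : 0 <= (2 * (l3 / (l1 * s)) - 433 / 432 * (F2 / l1 ^+ 2)) * p ^+ 2.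
  apply: mulr_ge0 (sqr_ge0 p).
  have : F2 / l1 ^+ 2 <= l3 / (l1 * s).
    rewrite -subr_ge0.
    have -> : l3 / (l1 * s) - F2 / l1 ^+ 2 = f / (l1 ^+ 2 * s).
      by rewrite /F2; field; rewrite ?sn ?l1n.
    by rewrite divr_ge0 ?mulr_ge0 ?sqr_ge0 ?ltW.
  have : 0 <= l3 / (l1 * s) by rewrite divr_ge0 ?mulr_ge0 ?ltW.
  lra.
have P3 : 0 <= (2 * (l2 / (l1 * s)) - 433 / 432 * (F3 / l1 ^+ 2)) * q ^+ 2.
  apply: mulr_ge0 (sqr_ge0 q).
  have : F3 / l1 ^+ 2 <= l2 / (l1 * s).
    rewrite -subr_ge0.
    have -> : l2 / (l1 * s) - F3 / l1 ^+ 2 = f / (l1 ^+ 2 * s).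
      by rewrite /F3; field; rewrite ?sn ?l1n.
    by rewrite divr_ge0 ?mulr_ge0 ?sqr_ge0 ?ltW.
  have : 0 <= l2 / (l1 * s) by rewrite divr_ge0 ?mulr_ge0 ?ltW.
  lra.
have P4 : 0 <= 2 / s * r ^+ 2 by rewrite mulr_ge0 ?sqr_ge0 ?divr_ge0 ?ltW.
lra.
Qed.

(** * Derivatives along lines and curves *)

Lemma is_derive_quotientP (R : realType) (V : normedModType R) (g : V -> R) x v
    (l : R) :
  is_derive x v g l <->
  (fun h : R => h^-1 * (g (x + h *: v) - g x)) @ 0^' --> l.
Proof.
have E : (fun h : R => h^-1 *: ((g \o shift x) (h *: v) - g x))
    = (fun h : R => h^-1 * (g (x + h *: v) - g x)).
  by apply/funext => h /=; rewrite [h *: v + x]addrC.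
split=> [[gx <-]|gl]; first by move: gx; rewrite /derive /derivable E => gx.
apply: DeriveDef; rewrite /derive /derivable E; last exact: cvg_lim gl.
by apply/cvg_ex; exists l.
Qed.

Lemma is_derive_line (R : realType) (V : normedModType R) (g : V -> R) x v
    (t l : R) :
  is_derive (x + t *: v) v g l <-> is_derive t (1 : R) (fun s => g (x + s *: v)) l.
Proof.
have E : (fun h : R => h^-1 * (g (x + t *: v + h *: v) - g (x + t *: v)))
    = (fun h => h^-1 * (g (x + (t + h *: (1 : R)) *: v) - g (x + t *: v))).
  by apply/funext => h; rewrite [h *: 1]mulr1 scalerDl addrA.
split=> /is_derive_quotientP H; apply/is_derive_quotientP.
  by move: H; rewrite E.
by rewrite E.
Qed.

Lemma is_derive_scale_dir (R : realType) (V : normedModType R) (g : V -> R) x v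
    (c l : R) :
  is_derive x v g l -> is_derive x (c *: v) g (c * l).
Proof.
rewrite -{1}[x](addr0) -{1}(scale0r v) => /is_derive_line gl.
rewrite -[x]addr0 -(scale0r (c *: v)); apply/is_derive_line.
have -> : (fun s : R => g (x + s *: (c *: v))) =
    (fun s => g (x + s *: v)) \o (c \*: (id : R -> R)).
  by apply/funext => s; rewrite /= scalerA mulrC.
rewrite mulrC; apply: is_derive1_comp; first by rewrite /= scaler0.
by apply: is_derive_eq; rewrite [LHS]mulr1.
Qed.

Lemma mean_value_segment (R : realType) (V : normedModType R) (g : V -> R) y v :
  (forall c : R, 0 <= c <= 1 -> derivable g (y + c *: v) v) ->
  exists2 c : R, 0 <= c <= 1 & g (y + v) - g y = 'D_v g (y + c *: v).
Proof.
move=> dg; pose h := fun s : R => g (y + s *: v).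
have dh (c : R) : c \in `[0, 1]%R ->
    is_derive c (1 : R) h ('D_v g (y + c *: v)).
  by rewrite in_itv /= => /dg/derivableP/is_derive_line.
have dh' (c : R) : c \in `]0, 1[%R ->
    is_derive c (1 : R) h ('D_v g (y + c *: v)).
  by move=> /subset_itv_oo_cc; exact: dh.
have ch : {within `[0 : R, 1], continuous h}.
  by apply: derivable_within_continuous => c /dh[].
have [c c01] := MVT_segment ler01 dh' ch.
rewrite /h scale1r scale0r addr0 subr0 mulr1 => gE.
by exists c => //; move: c01; rewrite in_itv.
Qed.

Lemma near_line (R : realType) (V : normedModType R) (P : set V) x v (t : R) :
  (\forall z \near x + t *: v, P z) -> \forall s \near t, P (x + s *: v).
Proof.
apply: (cvgD (cvg_cst x) (cvgZr_tmp _) : (fun s : R => x + s *: v) @ t --> _).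
exact: cvg_id.
Qed.

(** By the mean value theorem the quotient is a value of ['D_w g] at a point
between y and y + s w, which tends to x.  The value chosen when s = 0 lets the
lemma be multiplied by s / t without excluding the zeros of s. *)
Lemma moving_slope_cvg (R : realType) (V : normedModType R) (g : V -> R) x w
    (T : Type) (Fi : set_system T) {FF : Filter Fi} (y : T -> V) (s : T -> R) :
  (\forall z \near x, derivable g z w) -> {for x, continuous ('D_w g)} ->
  y @ Fi --> x -> s @ Fi --> (0 : R) ->
  (fun t => if s t == 0 then 'D_w g x
            else (s t)^-1 * (g (y t + s t *: w) - g (y t))) @ Fi --> 'D_w g x.
Proof.
move=> dg cg yx s0; apply/cvgrPdist_lt => e e0.
have : \forall z \near x, derivable g z w /\ `|'D_w g x - 'D_w g z| < e.
  apply: filterI => //; move/cvgrPdist_lt : cg; exact.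
move=> /nbhs_ballP[r /= r0 rP].
have w1 : 0 < `|w| + 1 by rewrite ltr_wpDl.
near=> t; case: ifPn => [_|st0]; first by rewrite subrr normr0.
have tP (c : R) : 0 <= c <= 1 -> ball x r (y t + c *: (s t *: w)).
  move=> /andP[c0 c1]; rewrite -ball_normE /= opprD addrA.
  apply: le_lt_trans (ler_normB _ _) _; rewrite !normrZ.
  apply: (@lt_le_trans _ _ (r / 2 + r / 2)); last by rewrite -splitr.
  apply: ltr_leD.
    by near: t; move/cvgrPdist_lt : yx; apply; rewrite divr_gt0.
  rewrite (ger0_norm c0); apply: (@le_trans _ _ (`|s t| * (`|w| + 1))).
    apply: (@le_trans _ _ (1 * (`|s t| * `|w|))); first by rewrite ler_wpM2r ?mulr_ge0.
    by rewrite mul1r ler_wpM2l // lerDl.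
  rewrite -ler_pdivlMr //; near: t.
  move/cvgr0Pnorm_le : s0; apply; rewrite !divr_gt0 //.
have dgs (c : R) : 0 <= c <= 1 -> is_derive (y t + c *: (s t *: w)) (s t *: w) g
    (s t * 'D_w g (y t + c *: (s t *: w))).
  by move=> /tP/rP[/derivableP + _]; apply: is_derive_scale_dir.
have [|c c01 ->] := @mean_value_segment _ _ g (y t) (s t *: w).
  by move=> c /dgs [].
have [_ ->] := dgs _ c01.
by rewrite mulKf //; have [_] := rP _ (tP _ c01).
Unshelve. all: by end_near. Qed.

(** The chain rule in the only form used below: the increment is split into one
along the line x + t a and one along w from the moving base point.  Taking
s(t) = c t gives additivity of the derivative in the direction; taking for s the
increment of u gives the derivative of f(x, u(x)). *)
Lemma is_derive_curve (R : realType) (V : normedModType R) (g : V -> R) x a w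
    (s : R -> R) (A s' : R) :
  is_derive x a g A ->
  (\forall z \near x, derivable g z w) -> {for x, continuous ('D_w g)} ->
  s 0 = 0 -> is_derive (0 : R) (1 : R) s s' ->
  is_derive (0 : R) (1 : R) (fun t : R => g (x + t *: a + s t *: w))
    (A + s' * 'D_w g x).
Proof.
move=> /is_derive_quotientP gA dg cg s00 ds.
have cs : s @ 0^' --> (0 : R).
  rewrite -[X in _ --> X]s00; apply: cvg_within_filter.
  by apply/differentiable_continuous/derivable1_diffP; exact: ex_derive.
move/is_derive_quotientP : ds => ds; apply/is_derive_quotientP.
have cy : (fun t : R => x + t *: a) @ 0^' --> x.
  rewrite -[X in _ --> X]addr0; apply: cvg_within_filter.
  apply: cvgD; first exact: cvg_cst.
  by rewrite -(scale0r a); apply: cvgZr_tmp; exact: cvg_id.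
have sl := moving_slope_cvg dg cg cy cs.
have /= L := cvgD gA (cvgM ds (sl _)).
apply: (cvg_trans _ (L _ _ _)); apply: near_eq_cvg; near=> t.
have t0 : t != 0 by near: t; exact: nbhs_dnbhs_neq.
have E0 : 0 + t *: (1 : R) = t by rewrite add0r; exact: mulr1.
rewrite E0 s00 !scale0r !addr0.
transitivity (t^-1 * (g (x + t *: a) - g x) + t^-1 * (s (0 + t *: 1) - 0) *
    (if s t == 0 then 'D_w g x
     else (s t)^-1 * (g (x + t *: a + s t *: w) - g (x + t *: a)))) => //.
rewrite E0 subr0; case: eqP => [->|/eqP st0].
  by rewrite !(mulr0, mul0r, scale0r, addr0).
by rewrite -mulrA mulVKf // -mulrDr; congr (_ * _); ring.
Unshelve. all: by end_near. Qed.

(** * Functions of class C^k *)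

Lemma eq_near_open (T : topologicalType) (S : Type) (U : set T) (f g : T -> S) x :
  open U -> U x -> (forall y, U y -> f y = g y) -> \forall y \near x, f y = g y.
Proof.
by move=> Uo Ux fg; near=> y; apply: fg; near: y; exact: open_nbhs_nbhs.
Unshelve. all: by end_near. Qed.

Lemma row1 (R : realType) n (i : 'I_n) : row i (1%:M : 'M[R]_n) = delta_mx 0 i.
Proof. by rewrite rowE mulmx1. Qed.

Lemma CkW (R : realType) n k (U : set 'rV[R]_n) g : Ck k.+1 U g -> Ck k U g.
Proof.
elim: k g => [|k IH] g [cg dg]; split=> // i.
by have [gi /IH Ci] := dg i.
Qed.

Lemma Ck_le (R : realType) n k m (U : set 'rV[R]_n) g :
  (m <= k)%N -> Ck k U g -> Ck m U g.
Proof.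
elim: k => [|k IH]; first by rewrite leqn0 => /eqP ->.
by rewrite leq_eqVlt => /predU1P[-> //|mk] /CkW; exact: IH.
Qed.

Lemma Ck_continuous (R : realType) n k (U : set 'rV[R]_n) g x :
  Ck k U g -> U x -> {for x, continuous g}.
Proof. by case: k => [|k] [cg _]; exact: cg. Qed.

Lemma Ck_ext (R : realType) n k (U : set 'rV[R]_n) f g :
  open U -> (forall x, U x -> f x = g x) -> Ck k U f -> Ck k U g.
Proof.
move=> Uo; elim: k f g => [|k IH] f g fg [cf df].
  split=> // x Ux; have fgx := eq_near_open Uo Ux fg.
  suff : g @ x --> g x by [].
  by rewrite -(fg x Ux); apply: cvg_trans (cf x Ux); exact: near_eq_cvg fgx.
split=> [x Ux|i].
  have fgx := eq_near_open Uo Ux fg.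
  suff : g @ x --> g x by [].
  by rewrite -(fg x Ux); apply: cvg_trans (cf x Ux); exact: near_eq_cvg fgx.
have [fi Cfi] := df i; split=> [x Ux|].
  exact: near_eq_derivable (eq_near_open Uo Ux fg) (fi x Ux).
apply: IH Cfi => x Ux; apply: near_eq_derive; exact: eq_near_open Uo Ux fg.
Qed.

Lemma Ck_lin (R : realType) n k (U : set 'rV[R]_n) (c : R) f g :
  open U -> Ck k U f -> Ck k U g -> Ck k U (fun x => c * f x + g x).
Proof.
move=> Uo; elim: k f g => [|k IH] f g [cf df] [cg dg].
  by split=> // x Ux; apply: cvgD (cg x Ux); apply: cvgM (cf x Ux); exact: cvg_cst.
split=> [x Ux|i].
  by apply: cvgD (cg x Ux); apply: cvgM (cf x Ux); exact: cvg_cst.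
have [fi Cfi] := df i; have [gi Cgi] := dg i.
have dl x : U x -> is_derive x (row i 1%:M) (fun x => c * f x + g x)
    (c * partial 1%:M i f x + partial 1%:M i g x).
  move=> Ux; apply: is_deriveD; last exact/derivableP/gi.
  by apply: is_deriveZ; exact/derivableP/fi.
split=> [x /dl[]//|].
by apply: Ck_ext (IH _ _ Cfi Cgi) => // x /dl [].
Qed.

Lemma Ck_sum (R : realType) n k (U : set 'rV[R]_n) (I : Type) (s : seq I)
    (c : I -> R) (f : I -> 'rV[R]_n -> R) :
  open U -> (forall i, Ck k U (f i)) -> Ck k U (fun x => \sum_(i <- s) c i * f i x).
Proof.
move=> Uo Cf; elim: s => [|i s IH].
  apply: (Ck_ext Uo (f := cst 0)) => [x _|]; first by rewrite big_nil.
  elim: k {Cf} => [|k IH]; first by split=> // x _; exact: cst_continuous.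
  split=> [x _|j]; first exact: cst_continuous.
  split=> [x _|]; first exact: derivable_cst.
  by apply: (Ck_ext Uo _ IH) => x _; rewrite /partial derive_cst.
apply: (Ck_ext Uo _ (Ck_lin (c i) Uo (Cf i) IH)) => x _.
by rewrite big_cons.
Qed.

(** The coordinates of v are added one at a time with [is_derive_curve], which
only asks the newly added partial derivative to be continuous. *)
Lemma C1_is_derive (R : realType) n (U : set 'rV[R]_n) g x v :
  open U -> Ck 1 U g -> U x ->
  is_derive x v g (\sum_j v 0 j * partial 1%:M j g x).
Proof.
move=> Uo [cg dg] Ux.
suff H s : is_derive x (\sum_(j <- s) v 0 j *: delta_mx 0 j) g
    (\sum_(j <- s) v 0 j * partial 1%:M j g x).
  by have := H (index_enum _); rewrite -row_sum_delta.
elim: s => [|j s IH]; first by rewrite !big_nil; exact: is_derive0.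
rewrite !big_cons addrC [X in is_derive _ _ _ X]addrC.
set a := \sum_(j <- s) _ in IH *; set A := \sum_(j <- s) _ in IH *.
set w := a + _.
rewrite -{1}[x]addr0 -{1}(scale0r w); apply/is_derive_line; rewrite /w.
have [dj [cj _]] := dg j.
have dnear : \forall z \near x, derivable g z (delta_mx 0 j).
  near=> z; rewrite -row1; apply: dj; near: z; exact: open_nbhs_nbhs.
have cnear : {for x, continuous ('D_(delta_mx 0 j) g)}.
  by rewrite -row1; exact: cj.
have ds : is_derive (0 : R) (1 : R) (v 0 j \*: (id : R -> R)) (v 0 j).
  by apply: is_derive_eq; rewrite [LHS]mulr1.
have := is_derive_curve IH dnear cnear _ ds.
rewrite /= scaler0 => /(_ erefl); rewrite /partial row1.
congr (is_derive _ _ _ _); apply/funext => t.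
by rewrite scalerDr scalerA addrA [_ *: t]mulrC.
Unshelve. all: by end_near. Qed.

Lemma Ck_derivable (R : realType) n k (U : set 'rV[R]_n) g x v :
  open U -> Ck k.+1 U g -> U x -> derivable g x v.
Proof.
move=> Uo Cg Ux.
by have [] := C1_is_derive v Uo (Ck_le (isT : (1 <= k.+1)%N) Cg) Ux.
Qed.

Lemma Ck_derive (R : realType) n k (U : set 'rV[R]_n) g v :
  open U -> Ck k.+1 U g -> Ck k U ('D_v g).
Proof.
move=> Uo Cg; apply: (Ck_ext Uo (f := fun x => \sum_j v 0 j * partial 1%:M j g x)).
  move=> x Ux.
  by have [_ ->] := C1_is_derive v Uo (Ck_le (isT : (1 <= k.+1)%N) Cg) Ux.
by apply: Ck_sum => // i; case: Cg => _ /(_ i)[].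
Qed.

(** The Hessian is the bilinear form of iterated directional derivatives; note
that its first index is the direction taken first. *)
Lemma derive2E (R : realType) n (U : set 'rV[R]_n) g x v w :
  open U -> Ck 2 U g -> U x ->
  'D_v ('D_w g) x = (w *m hess 1%:M g x *m v^T) 0 0.
Proof.
move=> Uo Cg Ux.
have Cw := Ck_derive w Uo Cg.
have [_ ->] := C1_is_derive v Uo Cw Ux.
rewrite mxE; apply: eq_bigr => j _; rewrite mulrC [v^T _ _]mxE; congr (_ * _).
rewrite /partial.
have -> : 'D_(row j 1%:M) ('D_w g) x =
   'D_(row j 1%:M) (\sum_k (fun y => w 0 k * partial 1%:M k g y)) x.
  apply: near_eq_derive; apply: eq_near_open Ux _ => // y Uy.
  have [_ ->] := C1_is_derive w Uo (CkW Cg) Uy.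
  by rewrite fct_sumE.
have dk k : is_derive x (row j 1%:M) (fun y => w 0 k * partial 1%:M k g y)
    (w 0 k * hess 1%:M g x k j).
  rewrite mxE; apply: is_deriveZ; apply: derivableP.
  by have [_ /(_ k)[_ Cgk]] := Cg; exact: (@Ck_derivable _ _ 0 U _ _ _ Uo Cgk Ux).
by have [_ ->] := is_derive_sum dk; rewrite mxE.
Qed.

(** The mean value theorem applied first along v to y |-> g(y + s w) - g(y), then
along w to ['D_v g]. *)
Lemma second_difference (R : realType) n (U : set 'rV[R]_n) g x v w (s : R) :
  open U -> Ck 2 U g ->
  (forall c d : R, 0 <= c <= s -> 0 <= d <= s -> U (x + c *: v + d *: w)) ->
  0 < s ->
  exists c d : R, [/\ 0 <= c <= s, 0 <= d <= s &
    g (x + s *: v + s *: w) - g (x + s *: v) - (g (x + s *: w) - g x) =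
    s ^+ 2 * 'D_w ('D_v g) (x + c *: v + d *: w)].
Proof.
move=> Uo Cg Us s0.
have ss (c : R) : 0 <= c <= 1 -> 0 <= c * s <= s.
  by move=> /andP[c0 c1]; rewrite mulr_ge0 ?ler_piMl // ltW.
have s00 : 0 <= (0 : R) <= s by rewrite lexx ltW.
have sss : 0 <= s <= s by rewrite lexx ltW.
pose h y := g (y + s *: w) - g y.
have dh (c : R) : 0 <= c <= s -> is_derive (x + c *: v) v h
    ('D_v g (x + c *: v + s *: w) - 'D_v g (x + c *: v)).
  move=> c01; apply: is_deriveB.
    have : derivable g (x + c *: v + s *: w) v.
      by apply: Ck_derivable Cg _ => //; apply: Us.
    move=> /derivableP/is_derive_quotientP H; apply/is_derive_quotientP.
    apply: cvg_trans H; apply: near_eq_cvg; near=> t.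
    by congr (_ * (g _ - _)); rewrite addrAC.
  apply: derivableP; apply: Ck_derivable Cg _ => //.
  by rewrite -[_ + _]addr0 -(scale0r w); apply: Us.
have dhs c : 0 <= c <= 1 -> is_derive (x + c *: (s *: v)) (s *: v) h
    (s * ('D_v g (x + (c * s) *: v + s *: w) - 'D_v g (x + (c * s) *: v))).
  by move=> /ss /dh H; rewrite scalerA; exact: is_derive_scale_dir.
have [c c01 hE] : exists2 c, 0 <= c <= 1 &
    h (x + s *: v) - h x = 'D_(s *: v) h (x + c *: (s *: v)).
  by apply: mean_value_segment => c /dhs [].
pose k := 'D_v g.
have dk (d : R) : 0 <= d <= 1 ->
    is_derive (x + (c * s) *: v + d *: (s *: w)) (s *: w) k
      (s * 'D_w k (x + (c * s) *: v + (d * s) *: w)).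
  move=> /ss dss; rewrite scalerA; apply: is_derive_scale_dir; apply: derivableP.
  by apply: Ck_derivable (Ck_derive v Uo Cg) _ => //; apply: Us => //; exact: ss.
have [d d01 kE] : exists2 d, 0 <= d <= 1 &
    k (x + (c * s) *: v + s *: w) - k (x + (c * s) *: v) =
    'D_(s *: w) k (x + (c * s) *: v + d *: (s *: w)).
  by apply: mean_value_segment => d /dk [].
exists (c * s), (d * s); split; [exact: ss|exact: ss|].
transitivity (h (x + s *: v) - h x) => //.
rewrite hE; have [_ ->] := dhs _ c01; rewrite -/k kE.
by have [_ ->] := dk _ d01; rewrite expr2 mulrA.
Unshelve. all: by end_near. Qed.

(** The second difference of [second_difference] is symmetric in v and w, so the
two mixed derivatives agree at two points close to x; let the side of the
parallelogram tend to 0. *)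
Lemma derive_comm (R : realType) n (U : set 'rV[R]_n) g x v w :
  open U -> Ck 2 U g -> U x -> 'D_v ('D_w g) x = 'D_w ('D_v g) x.
Proof.
move=> Uo Cg Ux.
have AC (a b c d : R) : a - b - (c - d) = a - c - (b - d) by ring.
have close (e a b c d : R) :
    d = c -> `|b - d| < e / 2 -> `|a - c| < e / 2 -> `|a - b| <= e.
  move=> -> H1 H2; have -> : a - b = (a - c) - (b - c) by ring.
  by apply: le_trans (ler_normB _ _) _; rewrite [e]splitr lerD // ltW.
have cvw := Ck_continuous (Ck_derive v Uo (Ck_derive w Uo Cg)) Ux.
have cwv := Ck_continuous (Ck_derive w Uo (Ck_derive v Uo Cg)) Ux.
apply/eqP; rewrite -subr_eq0 -normr_le0; apply/ler_addgt0Pr => e e0; rewrite add0r.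
have e2 : 0 < e / 2 by rewrite divr_gt0.
have : \forall z \near x, [/\ U z, `|'D_v ('D_w g) x - 'D_v ('D_w g) z| < e / 2
    & `|'D_w ('D_v g) x - 'D_w ('D_v g) z| < e / 2].
  have n1 : \forall z \near x, U z by exact: open_nbhs_nbhs.
  have n2 : \forall z \near x, `|'D_v ('D_w g) x - 'D_v ('D_w g) z| < e / 2.
    by move/cvgrPdist_lt : cvw => /(_ _ e2).
  have n3 : \forall z \near x, `|'D_w ('D_v g) x - 'D_w ('D_v g) z| < e / 2.
    by move/cvgrPdist_lt : cwv => /(_ _ e2).
  by apply: filterS3 n1 n2 n3 => z.
move=> /nbhs_ballP[r /= r0 rP].
pose N := `|v| + `|w| + 1.
have N0 : 0 < N by rewrite ltr_wpDl ?addr_ge0.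
pose s := r / 2 / N.
have s0 : 0 < s by rewrite !divr_gt0.
have sP a b (c d : R) : `|a| + `|b| + 1 = N -> 0 <= c <= s -> 0 <= d <= s ->
    ball x r (x + c *: a + d *: b).
  move=> abN /andP[c0 cs] /andP[d0 ds]; rewrite -ball_normE /=.
  rewrite -addrA opprD addNKr normrN.
  apply: le_lt_trans (ler_normD _ _) _; rewrite !normrZ !ger0_norm //.
  apply: (@le_lt_trans _ _ (s * `|a| + s * `|b|)).
    by apply: lerD; apply: ler_wpM2r.
  apply: (@lt_trans _ _ (s * N)); first by rewrite -mulrDr ltr_pM2l // -abN ltrDl.
  by rewrite /s divfK ?gt_eqF // ltr_pdivrMr // ltr_pMr // ltr1n.
have Nvw : `|v| + `|w| + 1 = N by [].
have Nwv : `|w| + `|v| + 1 = N by rewrite [`|w| + _]addrC.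
have [c [d [cs ds E1]]] := second_difference Uo Cg
  (fun c d cs ds => let: And3 H _ _ := rP _ (sP _ _ _ _ Nvw cs ds) in H) s0.
have [c' [d' [cs' ds' E2]]] := second_difference Uo Cg
  (fun c d cs ds => let: And3 H _ _ := rP _ (sP _ _ _ _ Nwv cs ds) in H) s0.
have [_ _ H1] := rP _ (sP _ _ _ _ Nvw cs ds).
have [_ H2 _] := rP _ (sP _ _ _ _ Nwv cs' ds').
have E : 'D_w ('D_v g) (x + c *: v + d *: w) = 'D_v ('D_w g) (x + c' *: w + d' *: v).
  apply: (@mulfI _ (s ^+ 2)); first by rewrite expf_neq0 // gt_eqF.
  refine (etrans (esym E1) (etrans _ E2)).
  have -> : x + s *: w + s *: v = x + s *: v + s *: w by exact: addrAC.
  exact: AC.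
exact: close E H1 H2.
Unshelve. all: by end_near. Qed.

Lemma derive_eq_on (R : realType) n (U : set 'rV[R]_n) (g h : 'rV[R]_n -> R) v x :
  open U -> U x -> (forall y, U y -> g y = h y) -> 'D_v g x = 'D_v h x.
Proof. by move=> Uo Ux gh; apply: near_eq_derive; exact: eq_near_open Uo Ux gh. Qed.

Lemma derive_comm4 (R : realType) n (U : set 'rV[R]_n) (g : 'rV[R]_n -> R) x v w :
  open U -> Ck 4 U g -> U x ->
  'D_v ('D_v ('D_w ('D_w g))) x = 'D_w ('D_w ('D_v ('D_v g))) x.
Proof.
move=> Uo C4 Ux.
have C3 : Ck 3 U g := CkW C4; have C2 : Ck 2 U g := CkW C3.
have C2v : Ck 2 U ('D_v g) := Ck_derive v Uo C3.
have C2w : Ck 2 U ('D_w g) := Ck_derive w Uo C3.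
have C2wv : Ck 2 U ('D_v ('D_w g)) := (Ck_derive v Uo (Ck_derive w Uo C4)).
have E1 y : U y -> 'D_v ('D_w ('D_w g)) y = 'D_w ('D_v ('D_w g)) y.
  by move=> Uy; exact: derive_comm Uo C2w Uy.
have E2 y : U y -> 'D_v ('D_v ('D_w g)) y = 'D_w ('D_v ('D_v g)) y.
  move=> Uy; refine (etrans (derive_eq_on v Uo Uy _) (derive_comm v w Uo C2v Uy)).
  by move=> z Uz; exact: (derive_comm v w Uo C2 Uz).
exact: (etrans (derive_eq_on v Uo Ux E1)
  (etrans (derive_comm v w Uo C2wv Ux) (derive_eq_on w Uo Ux E2))).
Qed.

(** * Second-order tests *)

Lemma second_derivative_test (R : realType) (f f1 : R -> R) (d : R) :
  (\forall t \near (0 : R), is_derive t (1 : R) f (f1 t)) ->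
  is_derive (0 : R) (1 : R) f1 d ->
  (\forall t \near (0 : R), f 0 <= f t) ->
  f1 0 = 0 /\ 0 <= d.
Proof.
move=> df d1 fmin.
have : \forall t \near (0 : R), is_derive t (1 : R) f (f1 t) /\ f 0 <= f t.
  exact: filterI.
move=> /nbhs_ballP[r /= r0 rP].
have rI (t : R) : t \in `]- r, r[%R -> is_derive t (1 : R) f (f1 t) /\ f 0 <= f t.
  move=> tr; apply: rP; rewrite -ball_normE /= sub0r normrN ltr_norml.
  by move: tr; rewrite in_itv.
have I0 : (0 : R) \in `]- r, r[%R by rewrite in_itv /= oppr_lt0 r0.
have f10 : f1 0 = 0.
  have [[_ <-] _] := rI _ I0.
  have rr : - r <= r by rewrite ge0_cp // ltW.
  have [_ //] := @derive1_at_min R f (- r) r 0 rr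
    (fun t tI => @ex_derive _ _ _ _ _ _ _ (rI t tI).1) I0 (fun t tI => (rI t tI).2).
split=> //; rewrite leNgt; apply/negP => d0.
(* f1 / t has a negative limit, so f1 < 0 just to the right of 0, and f would
   fall below f 0 there. *)
have : \forall t \near (0 : R)^', t^-1 * f1 t < 0.
  move/is_derive_quotientP : d1; rewrite f10 => H.
  near=> t.
  have tE : 0 + t *: (1 : R) = t by rewrite add0r; exact: mulr1.
  rewrite -[X in X < _](_ : t^-1 * (f1 (0 + t *: (1 : R)) - 0) = _).
    by near: t; exact: (cvgr_lt d H).
  by rewrite tE subr0.
rewrite near_withinE => /nbhs_ballP[e /= e0 eP].
pose t := Num.min r e / 2.
have m0 : 0 < Num.min r e by rewrite lt_min r0.
have t0 : 0 < t by rewrite divr_gt0.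
have tm : t < Num.min r e by rewrite ltr_pdivrMr // ltr_pMr // ltr1n.
have [tr te] : t < r /\ t < e by move: tm; rewrite lt_min => /andP.
have sub (c : R) : c \in `[0, t]%R -> c \in `]- r, r[%R.
  rewrite !in_itv /= => /andP[c0 ct]; rewrite (lt_le_trans _ c0) ?oppr_lt0 //=.
  exact: le_lt_trans tr.
have dI (c : R) : c \in `]0, t[%R -> is_derive c (1 : R) f (f1 c).
  by move=> /subset_itv_oo_cc /sub /rI [].
have cf : {within `[0 : R, t], continuous f}.
  by apply: derivable_within_continuous => c /sub /rI [[]].
have [c] := MVT t0 dI cf.
rewrite in_itv /= subr0 => /andP[c0 ct] E.
have ft : f 0 <= f t by apply: (rI t _).2; apply: sub; rewrite in_itv /= lexx ltW.
have : c^-1 * f1 c < 0.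
  apply: eP; last by rewrite gt_eqF.
  by rewrite -ball_normE /= sub0r normrN gtr0_norm // (lt_trans ct).
rewrite pmulr_rlt0 ?invr_gt0 // => fc.
by move: ft; rewrite -subr_ge0 E pmulr_lge0 // leNgt fc.
Unshelve. all: by end_near. Qed.

Lemma near_line0 (R : realType) (V : normedModType R) (P : set V) x v :
  (\forall z \near x, P z) -> \forall s \near (0 : R), P (x + s *: v).
Proof. by move=> H; apply: near_line; rewrite scale0r addr0. Qed.

Lemma near_line_open (R : realType) (V : normedModType R) (U : set V) x v :
  open U -> U x -> \forall s \near (0 : R), U (x + s *: v).
Proof. by move=> Uo Ux; apply: near_line0; exact: open_nbhs_nbhs. Qed.

Lemma is_derive_along (R : realType) n k (U : set 'rV[R]_n) g x v (t : R) :
  open U -> Ck k.+1 U g -> U (x + t *: v) ->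
  is_derive t (1 : R) (fun s => g (x + s *: v)) ('D_v g (x + t *: v)).
Proof.
move=> Uo Cg Ux; apply: (is_derive_line _ _ _ _ _).1.
exact: (derivableP (Ck_derivable (v := v) Uo Cg Ux)).
Qed.

Lemma is_derive_along0 (R : realType) n k (U : set 'rV[R]_n) g x v :
  open U -> Ck k.+1 U g -> U x ->
  is_derive (0 : R) (1 : R) (fun s => g (x + s *: v)) ('D_v g x).
Proof.
move=> Uo Cg Ux; have E : x + 0 *: v = x by rewrite scale0r addr0.
have Ux0 : U (x + 0 *: v) by rewrite E.
by have := is_derive_along Uo Cg Ux0; rewrite E.
Qed.

(** The function t |-> phi(x + t q) - ln a(x + t q) has a local minimum at 0. *)
Lemma touches_above_ln (R : realType) n (U V : set 'rV[R]_n) a phi x q :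
  open U -> Ck 2 U a -> U x -> 0 < a x ->
  open V -> Ck 2 V phi -> V x ->
  (\forall y \near x, ln (a y) <= phi y) -> phi x = ln (a x) ->
  'D_q phi x = 'D_q a x / a x /\
  'D_q ('D_q a) x / a x - ('D_q a x / a x) ^+ 2 <= 'D_q ('D_q phi) x.
Proof.
have log_second (p y z w : R) : y != 0 ->
  p - (y^-1 * z + w * (- y ^- 2 * w)) = p - (z / y - (w / y) ^+ 2).
  by move=> y0; field.
move=> Uo Ca Ux ax0 Vo Cphi Vx aphi phix.
pose A (t : R) := a (x + t *: q); pose A1 (t : R) : R := 'D_q a (x + t *: q).
pose P (t : R) := phi (x + t *: q); pose P1 (t : R) : R := 'D_q phi (x + t *: q).
have A0 : A 0 = a x by rewrite /A scale0r addr0.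
have A10 : A1 0 = 'D_q a x by rewrite /A1 scale0r addr0.
have P0 : P 0 = phi x by rewrite /P scale0r addr0.
have P10 : P1 0 = 'D_q phi x by rewrite /P1 scale0r addr0.
have apos : \forall y \near x, 0 < a y.
  have ca : a @ x --> a x by exact: (Ck_continuous Ca Ux).
  exact: cvgr_gt ca _ ax0.
have Apos : \forall t \near (0 : R), 0 < A t := near_line0 q apos.
have nU := near_line_open q Uo Ux; have nV := near_line_open q Vo Vx.
have df : \forall t \near (0 : R),
    is_derive t (1 : R) (P - (@ln R \o A)) (P1 t - (A t)^-1 * A1 t).
  apply: filterS3 Apos nU nV => t At Ut Vt.
  apply: is_deriveB; first exact: is_derive_along Vo Cphi Vt.
  apply: is_derive1_comp; first exact: is_derive1_ln.
  exact: is_derive_along Uo Ca Ut.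
have d1 : is_derive (0 : R) (1 : R) (P1 - (fun t => (A t)^-1) * A1)
    ('D_q ('D_q phi) x - ('D_q ('D_q a) x / a x - ('D_q a x / a x) ^+ 2)).
  have dA := is_derive_along0 q Uo Ca Ux.
  have dA1 := is_derive_along0 q Uo (Ck_derive q Uo Ca) Ux.
  have dP1 := is_derive_along0 q Vo (Ck_derive q Vo Cphi) Vx.
  have An0 : A 0 != 0 by rewrite A0 gt_eqF.
  have dAV : is_derive (0 : R) (1 : R) (fun t => (A t)^-1) (- (A 0) ^- 2 *: 'D_q a x).
    apply: DeriveDef; first by apply: derivableV => //; exact: ex_derive.
    by rewrite deriveV //; congr (_ *: _); exact: derive_val.
  have := is_deriveB dP1 (is_deriveM dAV dA1).
  congr (is_derive _ _ _ _).
  rewrite -/(A1 0) A0 A10 /GRing.scale /=.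
  by apply: log_second; rewrite gt_eqF.
have fmin : \forall t \near (0 : R), (P - (@ln R \o A)) 0 <= (P - (@ln R \o A)) t.
  apply: filterS (near_line0 q aphi) => t Ht.
  rewrite -[X in X <= _]/(P 0 - ln (A 0)) -[X in _ <= X]/(P t - ln (A t)).
  by rewrite A0 P0 phix subrr subr_ge0.
have [] := second_derivative_test df d1 fmin.
rewrite P10 A0 A10 => /eqP; rewrite subr_eq0 => /eqP -> ge0.
by rewrite mulrC -subr_ge0.
Qed.

Lemma convex_second_derivative (R : realType) n (U : set 'rV[R]_n) u x q :
  open U -> Ck 2 U u -> convex_function U u -> U x ->
  0 <= 'D_q ('D_q u) x.
Proof.
move=> Uo Cu cu Ux.
have half : 1 - 1 / 2 = 1 / 2 :> R by lra.
have half2 : 1 / 2 + 1 / 2 = 1 :> R by lra.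
have half_le (y z : R) : y <= 1 / 2 * z -> y + y <= z by lra.
(* By midpoint convexity this even function is minimal at 0; its second
   derivative there is twice that of u. *)
pose f (t : R) := u (x + t *: q) + u (x + t *: (- q)).
pose f1 (t : R) : R := 'D_q u (x + t *: q) - 'D_q u (x + t *: (- q)).
have DN y : U y -> 'D_(- q) u y = - 'D_q u y.
  move=> Uy; rewrite -(scaleN1r q) -(mulN1r ('D_q u y)).
  by have [] := is_derive_scale_dir (-1) (derivableP (Ck_derivable (v := q) Uo Cu Uy)).
have DN2 : 'D_(- q) ('D_q u) x = - 'D_q ('D_q u) x.
  rewrite -(scaleN1r q) -(mulN1r ('D_q ('D_q u) x)).
  by have [] := is_derive_scale_dir (-1)
    (derivableP (Ck_derivable (v := q) Uo (Ck_derive q Uo Cu) Ux)).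
have nU := near_line_open q Uo Ux; have nV := near_line_open (- q) Uo Ux.
have df : \forall t \near (0 : R), is_derive t (1 : R) f (f1 t).
  apply: filterS2 nU nV => t Up Un.
  have := is_deriveD (is_derive_along Uo Cu Up) (is_derive_along Uo Cu Un).
  by rewrite DN.
have d1 : is_derive (0 : R) (1 : R) f1 ('D_q ('D_q u) x + 'D_q ('D_q u) x).
  have C1 := Ck_derive q Uo Cu.
  have := is_deriveB (is_derive_along0 q Uo C1 Ux) (is_derive_along0 (- q) Uo C1 Ux).
  by rewrite DN2 opprK.
have fmin : \forall t \near (0 : R), f 0 <= f t.
  apply: filterS2 nU nV => t Up Un.
  have h0 : (0 : R) <= 1 / 2 by rewrite divr_ge0.
  have h1 : (1 / 2 : R) <= 1 by rewrite mul1r invf_le1 // ler1n.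
  have H : u ((1 / 2 : R) *: (x + t *: q) + (1 - 1 / 2 : R) *: (x + t *: (- q))) <=
      1 / 2 * u (x + t *: q) + (1 - 1 / 2) * u (x + t *: (- q)).
    have := cu (Itv01 h0 h1) (x + t *: q) (x + t *: (- q)).
    by rewrite !inE => /(_ Up Un).
  move: H; rewrite half.
  have -> : (1 / 2 : R) *: (x + t *: q) + (1 / 2 : R) *: (x + t *: (- q)) = x.
    rewrite scalerN -scalerDr addrACA subrr addr0 scalerDr -scalerDl.
    by rewrite half2 scale1r.
  rewrite /f !scale0r !addr0 -mulrDr => H.
  exact: half_le H.
by have [_] := second_derivative_test df d1 fmin; rewrite -mulr2n pmulrn_lge0.
Qed.

(** * Euclidean balls and cylinders *)

Lemma enorm_ge0 (R : realType) n (x : 'rV[R]_n) : 0 <= enorm x.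
Proof. exact: sqrtr_ge0. Qed.

Lemma coord_le_enorm (R : realType) n (x : 'rV[R]_n) i : `|x 0 i| <= enorm x.
Proof.
rewrite -sqrtr_sqr ler_wsqrtr // (bigD1 i) //= lerDl.
by apply: sumr_ge0 => j _; exact: sqr_ge0.
Qed.

Lemma normr_le_enorm (R : realType) n (x : 'rV[R]_n) : `|x| <= enorm x.
Proof.
have [x0|x0] := eqVneq (mx_norm x) 0.
  by apply: (@le_trans _ _ 0); [rewrite -x0|exact: enorm_ge0].
have [[i j] /= xE] := mx_norm_neq0 x0.
by apply: le_trans (coord_le_enorm x j); rewrite -(ord1 i) -xE.
Qed.

Lemma enorm_gt0 (R : realType) n (x : 'rV[R]_n) : x != 0 -> 0 < enorm x.
Proof. by move=> x0; apply: lt_le_trans (normr_le_enorm x); rewrite normr_gt0. Qed.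

Lemma enorm_le (R : realType) n (x : 'rV[R]_n) (r : R) :
  0 <= r -> (enorm x <= r) = (\sum_i x 0 i ^+ 2 <= r ^+ 2).
Proof.
move=> r0; have {1}-> : r = Num.sqrt (r ^+ 2) by rewrite sqrtr_sqr ger0_norm.
by rewrite ler_sqrt // sqr_ge0.
Qed.

Lemma enorm_le_sum (R : realType) n (x : 'rV[R]_n) : enorm x <= \sum_i `|x 0 i|.
Proof.
rewrite enorm_le ?sumr_ge0 //.
elim: (index_enum _) => [|i s IH]; first by rewrite !big_nil expr0n.
rewrite !big_cons sqrrD -addrA real_normK ?num_real // lerD2l.
by apply: le_trans IH _; rewrite lerDr mulrn_wge0 // mulr_ge0 // sumr_ge0.
Qed.

(** Stated for a selection h of the coordinates, so as to cover both the norm on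
R^n and the norm of the first n coordinates on R^(n+1). *)
Lemma continuous_sqrt_sum (R : realType) m n (h : 'I_m -> 'I_n) :
  continuous (fun p : 'rV[R]_n => Num.sqrt (\sum_i p 0 (h i) ^+ 2)).
Proof.
have sum_cont : continuous (fun p : 'rV[R]_n => \sum_i p 0 (h i) ^+ 2).
  apply: (@continuous_big R _ +%R 0 xpredT); first exact: add_continuous.
  move=> i _ p; apply: (@continuous_comp _ _ _ (fun p : 'rV[R]_n => p 0 (h i))
    (fun y : R => y ^+ 2)); first exact: coord_continuous.
  exact: exprn_continuous.
move=> p; apply: (@continuous_comp _ _ _ _ (@Num.sqrt R)); first exact: sum_cont.
exact: sqrt_continuous.
Qed.

Lemma enorm_continuous (R : realType) n : continuous (@enorm R n).
Proof. exact: (@continuous_sqrt_sum R n n id). Qed.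

Lemma eball_open (R : realType) n (r : R) : open (@eball R n r).
Proof.
apply: (@open_comp _ _ (@enorm R n) [set y | y < r]); last exact: open_lt.
by move=> x _; exact: enorm_continuous.
Qed.

Lemma ecball_closed (R : realType) n (r : R) : closed (@ecball R n r).
Proof.
apply: (@preimage_closed _ _ (@enorm R n) [set y | y <= r]); last exact: closed_le.
by move=> x _; exact: enorm_continuous.
Qed.

Lemma bounded_setP (R : realType) n (A : set 'rV[R]_n) (B : R) :
  (forall x, A x -> `|x| <= B) -> bounded_set A.
Proof.
move=> AB; exists B; split=> [|M BM x /AB /le_trans]; rewrite ?num_real //.
by apply; exact: ltW.
Qed.

Lemma ecball_compact (R : realType) n (r : R) : compact (@ecball R n r).
Proof.
apply: bounded_closed_compact; last exact: ecball_closed.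
by apply: (@bounded_setP _ _ _ r) => x; apply: le_trans (normr_le_enorm x).
Qed.

Lemma enorm_lsubmx (R : realType) n (p : 'rV[R]_(n + 1)) :
  enorm (lsubmx p) = Num.sqrt (\sum_i p 0 (lshift 1 i) ^+ 2).
Proof. by congr Num.sqrt; apply: eq_bigr => i _; rewrite mxE. Qed.

Lemma cyl_open (R : realType) n (r : R) :
  open (cyl (@eball R n r) [set: R]).
Proof.
have -> : cyl (@eball R n r) [set: R] =
    (fun p => Num.sqrt (\sum_i p 0 (lshift 1 i) ^+ 2)) @^-1` [set y | y < r].
  by apply/seteqP; split=> p /=; rewrite /cyl /eball /= enorm_lsubmx; [case|].
apply: open_comp; last exact: open_lt.
by move=> x _; exact: continuous_sqrt_sum.
Qed.

Lemma cyl_compact (R : realType) n (r M : R) :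
  compact (cyl (@ecball R n r) `[- M, M]).
Proof.
apply: bounded_closed_compact.
  apply: (@bounded_setP _ _ _ (Num.max r M)) => p [pr pM].
  have [p0|p0] := eqVneq (mx_norm p) 0.
    apply: (@le_trans _ _ 0); first by rewrite -p0.
    by rewrite le_max (le_trans (enorm_ge0 _) pr).
  have [[i j] /= pE] := mx_norm_neq0 p0.
  apply: (@le_trans _ _ `|p 0 j|); first by rewrite -(ord1 i) -pE.
  rewrite le_max; case: (split_ordP j) => k ->.
    apply/orP; left; apply: le_trans pr.
    by have := coord_le_enorm (lsubmx p) k; rewrite mxE.
  apply/orP; right; move: pM; rewrite /= in_itv /= mxE [k]ord1 -ler_norml.
  by [].
have -> : cyl (@ecball R n r) `[- M, M] =
    ((fun p => Num.sqrt (\sum_i p 0 (lshift 1 i) ^+ 2)) @^-1` [set y | y <= r])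
    `&` ((fun p => p 0 (rshift n 0)) @^-1` `[- M, M]).
  by apply/seteqP; split=> p /=; rewrite /cyl /ecball /= enorm_lsubmx mxE.
apply: closedI; apply: preimage_closed.
- by move=> x _; exact: continuous_sqrt_sum.
- exact: closed_le.
- by move=> x _; exact: coord_continuous.
- exact: interval_closed.
Qed.

(** * Norms on compact sets *)

(** By convention, the supremum of a set without a least upper bound is 0. *)
Lemma sup_ge0 (R : realType) (A : set R) : (forall z, A z -> 0 <= z) -> 0 <= sup A.
Proof.
move=> A0; have [hA|/sup_out -> //] := pselect (has_sup A).
by have [[z Az] ubA] := hA; apply: le_trans (A0 z Az) (ub_le_sup ubA Az).
Qed.

Lemma supnorm_ge0 (R : realType) n (K : set 'rV[R]_n) g : 0 <= supnorm K g.
Proof. by apply: sup_ge0 => _ [x _ <-]. Qed.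

Lemma lipnorm_ge0 (R : realType) n (K : set 'rV[R]_n) d :
  (forall x y, 0 <= d x y) -> 0 <= lipnorm K d.
Proof.
move=> d0; apply: sup_ge0 => _ [x [y [_ _ _ ->]]].
by rewrite divr_ge0 ?enorm_ge0.
Qed.

Lemma compact_image_bounded (R : realType) n (K : set 'rV[R]_n) (g : 'rV[R]_n -> R) :
  compact K -> (forall x, K x -> {for x, continuous g}) ->
  exists B, forall x, K x -> `|g x| <= B.
Proof.
move=> cK cg.
have /compact_bounded[B [_ HB]] : compact (g @` K).
  apply: continuous_compact cK; apply: continuous_in_subspaceT => x.
  by rewrite inE; exact: cg.
exists (B + 1) => x Kx; apply: (HB (B + 1)); first by rewrite ltrDl.
by exists x.
Qed.

Lemma supnorm_ub (R : realType) n (K : set 'rV[R]_n) (g : 'rV[R]_n -> R) x :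
  compact K -> (forall x, K x -> {for x, continuous g}) ->
  K x -> `|g x| <= supnorm K g.
Proof.
move=> cK cg Kx; have [B HB] := compact_image_bounded cK cg.
apply: ub_le_sup; last by exists x.
by exists B => _ [y Ky <-]; exact: HB.
Qed.

Lemma lipnorm_ub (R : realType) n (K : set 'rV[R]_n) d (B : R) x y :
  (forall z, d z z = 0) ->
  (forall x y, K x -> K y -> d x y <= B * enorm (x - y)) ->
  K x -> K y -> d x y <= lipnorm K d * enorm (x - y).
Proof.
move=> d0 dB Kx Ky; have [<-|xy] := eqVneq x y.
  rewrite d0 subrr /enorm big1 ?sqrtr0 ?mulr0 // => i _.
  by rewrite mxE expr0n.
have e0 : 0 < enorm (x - y) by rewrite enorm_gt0 // subr_eq0.
rewrite -ler_pdivrMr //; apply: ub_le_sup; last by exists x, y.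
exists B => _ [a [b [Ka Kb ab ->]]].
by rewrite ler_pdivrMr ?dB // enorm_gt0 // subr_eq0.
Qed.

Lemma compact_inf_gt0 (R : realType) n (K : set 'rV[R]_n) (g : 'rV[R]_n -> R) :
  compact K -> K !=set0 -> (forall x, K x -> {for x, continuous g}) ->
  (forall x, K x -> 0 < g x) ->
  0 < inf [set g x | x in K] /\ (forall x, K x -> inf [set g x | x in K] <= g x).
Proof.
move=> cK K0 cg g0.
have cgK : {within K, continuous g}.
  by apply: continuous_in_subspaceT => x; rewrite inE; exact: cg.
have [c] := compact_EVT_min K0 cK cgK; rewrite inE => Kc cmin.
have lbc : lbound [set g x | x in K] (g c).
  by move=> _ [x Kx <-]; apply: cmin; rewrite inE.
split.
  apply: lt_le_trans (g0 c Kc) (lb_le_inf _ lbc).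
  by exists (g c); exists c.
by move=> x Kx; apply: ge_inf; [exists (g c)|exists x].
Qed.

(** The difference quotients are locally bounded on K x K: near the diagonal by
the local Lipschitz condition, off the diagonal by continuity of g and because
the denominator stays away from 0.  The product K x K is compact. *)
Lemma compact_lipschitz (R : realType) n (K : set 'rV[R]_n) (g : 'rV[R]_n -> R) :
  compact K -> (forall x, K x -> {for x, continuous g}) ->
  (forall x, K x -> exists2 W, nbhs x W & [lipschitz g q | q in W]) ->
  exists B, forall x y, K x -> K y -> `|g x - g y| <= B * enorm (x - y).
Proof.
move=> cK cg lg.
pose P (B : R) (p : 'rV[R]_n * 'rV[R]_n) := `|g p.1 - g p.2| <= B * `|p.1 - p.2|.
have PW B B' p : B <= B' -> P B p -> P B' p.
  by move=> BB /le_trans; apply; apply: ler_wpM2r.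
have loc p : (K `*` K) p -> exists B, \forall q \near p, P B q.
  case: p => x y [/= Kx Ky]; have [<-|xy] := eqVneq x y.
    have [W Wx [B [_ HB]]] := lg x Kx; exists (B + 1).
    exists (W, W) => [|q Wq]; first by split.
    by have := HB (B + 1); rewrite ltrDl => /(_ ltr01) /(_ q Wq).
  have d0 : 0 < `|x - y| / 4 by rewrite divr_gt0 // normr_gt0 subr_eq0.
  exists ((`|g x| + `|g y| + 2) / (`|x - y| / 2)).
  have nx : \forall z \near x, `|x - z| < `|x - y| / 4 /\ `|g x - g z| < 1.
    apply: filterI; first by apply/nbhs_ballP; exists (`|x - y| / 4); rewrite -?ball_normE.
    by have /cvgrPdist_lt := cg x Kx; exact.
  have ny : \forall z \near y, `|y - z| < `|x - y| / 4 /\ `|g y - g z| < 1.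
    apply: filterI; first by apply/nbhs_ballP; exists (`|x - y| / 4); rewrite -?ball_normE.
    by have /cvgrPdist_lt := cg y Ky; exact.
  exists ([set z | `|x - z| < `|x - y| / 4 /\ `|g x - g z| < 1],
    [set z | `|y - z| < `|x - y| / 4 /\ `|g y - g z| < 1]) => //.
  move=> [a b] [[/= xa ga] [/= yb gb]]; rewrite /P /=.
  have ab : `|x - y| / 2 <= `|a - b|.
    have := ler_distD a x b; have := ler_distD b x y; rewrite (distrC b y).
    move: xa yb; move: `|x - y| `|x - a| `|y - b| `|a - b| `|x - b| => *; lra.
  have e0 : 0 < `|x - y| / 2 by move: d0; move: `|x - y| => *; lra.
  have gab : `|g a - g b| <= `|g x| + `|g y| + 2.
    have := ler_distD (g x) (g a) (g b); have := ler_distD (g y) (g x) (g b).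
    have := ler_normB (g x) (g y); rewrite (distrC (g a) (g x)).
    move: ga gb; move: `|g a - g b| `|g x - g a| `|g x - g b| `|g y - g b|.
    by move: `|g x - g y| `|g x| `|g y| => *; lra.
  apply: le_trans gab _; rewrite mulrAC ler_pdivlMr //.
  by apply: ler_wpM2l ab; rewrite !addr_ge0.
have /compact_near_coveringP ncov := compact_setX cK cK.
have [p Kp|B [_ HB]] := ncov _ (pinfty_nbhs R) P _ _.
  have [B HB] := loc p Kp.
  exists ([set q | P B q], [set B' | B <= B']) => /= [|[q B'] [/= ? BB]].
    by split=> //; exact: nbhs_pinfty_ge (num_real B).
  exact: PW BB _.
exists `|B + 1| => x y Kx Ky.
have := HB (B + 1); rewrite ltrDl => /(_ ltr01 (x, y) (conj Kx Ky)) /= H.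
apply: (@le_trans _ _ (`|B + 1| * `|x - y|)).
  by apply: PW H; exact: ler_norm.
by apply: ler_wpM2l (normr_le_enorm _).
Qed.

Lemma enormZ (R : realType) n (c : R) (x : 'rV[R]_n) :
  enorm (c *: x) = `|c| * enorm x.
Proof.
rewrite /enorm -sqrtr_sqr -sqrtrM ?sqr_ge0 //; congr Num.sqrt.
by rewrite mulr_sumr; apply: eq_bigr => i _; rewrite mxE exprMn.
Qed.

(** Convexity of the square, coordinate by coordinate. *)
Lemma ecball_segment (R : realType) n (r : R) (x y : 'rV[R]_n) (c : R) :
  ecball r x -> ecball r y -> 0 <= c <= 1 -> ecball r (x + c *: (y - x)).
Proof.
move=> xr yr /andP[c0 c1]; have r0 : 0 <= r := le_trans (enorm_ge0 _) xr.
move: xr yr; rewrite /ecball /= !enorm_le // => xr yr.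
have -> : r ^+ 2 = (1 - c) * r ^+ 2 + c * r ^+ 2 by rewrite -mulrDl subrK mul1r.
have c1' : 0 <= 1 - c by rewrite subr_ge0.
apply: le_trans (lerD (ler_wpM2l c1' xr) (ler_wpM2l c0 yr)).
rewrite !mulr_sumr -big_split /=; apply: ler_sum => i _; rewrite !mxE.
have -> : (x 0 i + c * (y 0 i - x 0 i)) ^+ 2 = (1 - c) * x 0 i ^+ 2 + c * y 0 i ^+ 2
    - (1 - c) * c * (x 0 i - y 0 i) ^+ 2 by ring.
by rewrite gerBl mulr_ge0 ?sqr_ge0 // mulr_ge0.
Qed.

Lemma eball_ecball (R : realType) n (r r' : R) (x : 'rV[R]_n) :
  r < r' -> ecball r x -> eball r' x.
Proof. by move=> rr xr; apply: le_lt_trans rr. Qed.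

(** The mean value theorem on the segment from y to x, along which the partial
derivatives are bounded by compactness. *)
Lemma C1_lipschitz_ball (R : realType) n (r r' : R) (u : 'rV[R]_n -> R) :
  r < r' -> Ck 1 (eball r') u ->
  exists B, forall x y, ecball r x -> ecball r y -> `|u x - u y| <= B * enorm (x - y).
Proof.
move=> rr Cu.
have bj j : exists B, forall x, ecball r x -> `|partial 1%:M j u x| <= B.
  apply: compact_image_bounded; first exact: ecball_compact.
  move=> x /(eball_ecball rr) xr; case: Cu => _ /(_ j)[_ [+ _]].
  by apply.
have [B HB] := choice bj.
exists (\sum_j B j) => x y Kx Ky.
have seg c : 0 <= c <= 1 -> eball r' (y + c *: (x - y)).
  by move=> c01; apply: eball_ecball rr (ecball_segment Ky Kx c01).
have [c c01] := mean_value_segment (fun c c01 =>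
  Ck_derivable (v := x - y) (@eball_open R n r') Cu (seg c c01)).
rewrite (addrC y (x - y)) subrK => ->.
have [_ ->] := C1_is_derive (x - y) (@eball_open R n r') Cu (seg c c01).
apply: le_trans (ler_norm_sum _ _ _) _; rewrite mulr_suml; apply: ler_sum => j _.
rewrite normrM mulrC; apply: ler_pM => //; last exact: coord_le_enorm.
by apply: HB; exact: ecball_segment.
Qed.

Lemma is_derive_le (R : realType) (V : normedModType R) (g : V -> R) x v (l B : R) :
  is_derive x v g l ->
  (\forall t \near (0 : R), `|g (x + t *: v) - g x| <= B * `|t|) -> `|l| <= B.
Proof.
move=> /is_derive_quotientP gl gB.
have nl : (fun h : R => `|h^-1 * (g (x + h *: v) - g x)|) @ 0^' --> `|l|.
  exact: cvg_norm gl.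
have <- := cvg_lim (@Rhausdorff R) nl.
apply: limr_le; first by apply/cvg_ex; exists `|l|.
near=> t.
have t0 : t != 0 by near: t; exact: nbhs_dnbhs_neq.
rewrite normrM normfV mulrC ler_pdivrMr ?normr_gt0 //.
near: t; exact: cvg_within gB.
Unshelve. all: by end_near. Qed.

Section norms.
Variables (R : realType) (n : nat).

Lemma lip_normC01 (u : 'rV[R]_n -> R) (r r' : R) x y :
  r < r' -> Ck 1 (eball r') u -> ecball r x -> ecball r y ->
  `|u x - u y| <= normC01 (ecball r) u * enorm (x - y).
Proof.
move=> rr Cu xr yr; have [B HB] := C1_lipschitz_ball rr Cu.
have d0 z : `|u z - u z| = 0 by rewrite subrr normr0.
apply: le_trans (lipnorm_ub d0 HB xr yr) _.
by rewrite ler_wpM2r ?enorm_ge0 // lerDr supnorm_ge0.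
Qed.

Lemma derive_le_normC01 (u : 'rV[R]_n -> R) (r r' : R) x q :
  r < r' -> Ck 1 (eball r') u -> eball r x -> enorm q = 1 ->
  `|'D_q u x| <= normC01 (ecball r) u.
Proof.
move=> rr Cu xr q1.
have xr' : eball r' x := lt_trans xr rr.
have dq := derivableP (Ck_derivable (v := q) (@eball_open R n r') Cu xr').
apply: is_derive_le dq _.
have := near_line_open q (@eball_open R n r) xr.
apply: filterS => t xt.
apply: le_trans (lip_normC01 rr Cu (ltW xt) (ltW xr)) _.
by rewrite addrC addKr enormZ q1 mulr1.
Qed.

Variables (U K : set 'rV[R]_n) (g : 'rV[R]_n -> R).
Hypotheses (cK : compact K) (KU : K `<=` U) (Cg : C11 U g).

Let Cg1 : Ck 1 U g. Proof. by case: Cg. Qed.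

Let partial_cont j x : K x -> {for x, continuous (partial 1%:M j g)}.
Proof. by move=> /KU Ux; case: Cg1 => _ /(_ j)[_ [+ _]]; apply. Qed.

Let grad_coord x j : grad 1%:M g x 0 j = partial 1%:M j g x.
Proof. by rewrite mxE. Qed.

Lemma partial_le_normC11 j x : K x -> `|partial 1%:M j g x| <= normC11 K g.
Proof.
move=> Kx; rewrite -grad_coord; apply: le_trans (coord_le_enorm _ _) _.
have cgr y : K y -> {for y, continuous (fun x => enorm (grad 1%:M g x))}.
  move=> Ky.
  have -> : (fun x => enorm (grad 1%:M g x)) =
     (@Num.sqrt R) \o (fun x => \sum_j partial 1%:M j g x ^+ 2).
    apply/funext => z; rewrite /= /enorm; congr Num.sqrt.
    by apply: eq_bigr => i _; rewrite grad_coord.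
  apply: continuous_comp; last exact: sqrt_continuous.
  apply: (@cvg_big R _ +%R 0 xpredT add_continuous _ (nbhs y) _ _ _ (nbhs_filter y)) => i _.
  apply: (@continuous_comp _ _ _ (partial 1%:M i g) (fun y : R => y ^+ 2)).
    exact: partial_cont.
  exact: exprn_continuous.
apply: le_trans (ler_norm _) (le_trans (supnorm_ub cK cgr Kx) _).
rewrite /normC11 addrAC lerDr addr_ge0 ?supnorm_ge0 ?lipnorm_ge0 // => *.
exact: enorm_ge0.
Qed.

Lemma partial_lip_normC11 j x y : K x -> K y ->
  `|partial 1%:M j g x - partial 1%:M j g y| <= normC11 K g * enorm (x - y).
Proof.
move=> Kx Ky.
pose d x y := enorm (grad 1%:M g x - grad 1%:M g y).
have dE x' y' k : (grad 1%:M g x' - grad 1%:M g y') 0 k =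
   partial 1%:M k g x' - partial 1%:M k g y' by rewrite !mxE.
have bj k : exists B, forall x y, K x -> K y ->
    `|partial 1%:M k g x - partial 1%:M k g y| <= B * enorm (x - y).
  apply: compact_lipschitz => // [z|z Kz]; first exact: partial_cont.
  by case: Cg => _ /(_ k z (KU Kz)).
have [B HB] := choice bj.
have dB x' y' : K x' -> K y' -> d x' y' <= (\sum_k B k) * enorm (x' - y').
  move=> Kx' Ky'; apply: le_trans (enorm_le_sum _) _.
  by rewrite mulr_suml; apply: ler_sum => k _; rewrite dE HB.
have d0 z : d z z = 0.
  by rewrite /d subrr /enorm big1 ?sqrtr0 // => i _; rewrite mxE expr0n.
rewrite -dE; apply: le_trans (coord_le_enorm _ _) _.
apply: le_trans (lipnorm_ub d0 dB Kx Ky) _.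
rewrite ler_wpM2r ?enorm_ge0 // /normC11 lerDr addr_ge0 ?supnorm_ge0 //.
Qed.

End norms.

(** * The equation det = g tr, differentiated twice *)

Lemma det3 (R : comNzRingType) (A : 'M[R]_3)
    (o0 := ord0 : 'I_3) (o1 := lift ord0 ord0 : 'I_3)
    (o2 := lift ord0 (lift ord0 ord0) : 'I_3) :
  \det A = A o0 o0 * (A o1 o1 * A o2 o2 - A o1 o2 * A o2 o1)
         - A o0 o1 * (A o1 o0 * A o2 o2 - A o1 o2 * A o2 o0)
         + A o0 o2 * (A o1 o0 * A o2 o1 - A o1 o1 * A o2 o0).
Proof.
rewrite (expand_det_row _ ord0) !big_ord_recl big_ord0 /cofactor.
rewrite !(expand_det_row _ ord0) !big_ord_recl !big_ord0 /cofactor.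
rewrite !(expand_det_row _ ord0) !big_ord_recl !big_ord0 /cofactor.
rewrite !det_mx00 !mxE /=.
have E10 : lift (lift ord0 ord0) ord0 = ord0 :> 'I_2 by apply: val_inj.
have F10 : lift (lift ord0 ord0) ord0 = ord0 :> 'I_3 by apply: val_inj.
have F11 : lift (lift ord0 ord0) (lift ord0 ord0) = lift ord0 (lift ord0 ord0) :> 'I_3.
  by apply: val_inj.
have F20 : lift (lift ord0 (lift ord0 ord0)) ord0 = ord0 :> 'I_3 by apply: val_inj.
have F21 : lift (lift ord0 (lift ord0 ord0)) (lift ord0 ord0) = lift ord0 ord0 :> 'I_3.
  by apply: val_inj.
rewrite !(E10, F10, F11, F20, F21) -/o0 -/o1 -/o2 /bump /=.
by ring.
Qed.

Lemma is_derive_mul3 (R : realType) (a b c : R -> R) (t a1 b1 c1 : R) :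
  is_derive t (1 : R) a a1 -> is_derive t (1 : R) b b1 -> is_derive t (1 : R) c c1 ->
  is_derive t (1 : R) (a * b * c) (a1 * b t * c t + a t * b1 * c t + a t * b t * c1).
Proof.
have alg (x y z x1 y1 z1 : R) :
  x * y * z1 + z * (x * y1 + y * x1) = x1 * y * z + x * y1 * z + x * y * z1 by ring.
move=> da db dc; apply: is_derive_eq; rewrite /GRing.scale /=; exact: alg.
Qed.

(** The function is the determinant of the symmetric matrix with diagonal a, b, c
and entries p, q, r at the places (1,2), (1,3), (2,3).  Its first derivative is
needed as a function, hence in this unsimplified form. *)
Lemma is_derive_symdet (R : realType) (a b c p q r : R -> R)
    (t a1 b1 c1 p1 q1 r1 : R) :
  is_derive t (1 : R) a a1 -> is_derive t (1 : R) b b1 -> is_derive t (1 : R) c c1 ->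
  is_derive t (1 : R) p p1 -> is_derive t (1 : R) q q1 -> is_derive t (1 : R) r r1 ->
  is_derive t (1 : R)
    (a * b * c + (p * q * r + p * q * r) - a * r * r - b * q * q - c * p * p)
    (a1 * b t * c t + a t * b1 * c t + a t * b t * c1
     + (p1 * q t * r t + p t * q1 * r t + p t * q t * r1
        + (p1 * q t * r t + p t * q1 * r t + p t * q t * r1))
     - (a1 * r t * r t + a t * r1 * r t + a t * r t * r1)
     - (b1 * q t * q t + b t * q1 * q t + b t * q t * q1)
     - (c1 * p t * p t + c t * p1 * p t + c t * p t * p1)).
Proof.
move=> da db dc dp dq dr.
have pqr := is_derive_mul3 dp dq dr.
exact: (is_deriveB (is_deriveB (is_deriveB
  (is_deriveD (is_derive_mul3 da db dc) (is_deriveD pqr pqr))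
  (is_derive_mul3 da dr dr)) (is_derive_mul3 db dq dq)) (is_derive_mul3 dc dp dp)).
Qed.

(** The identity det = g tr along a curve of symmetric matrices, diagonal at time
0.  The derivative g1 is only assumed to be a derivative of g: that g1 is itself
differentiable at 0 follows from the identity, because the trace does not
vanish. *)
Section det_equation.
Variables (R : realType) (I : set R).
Variables a b c p q r g : R -> R.
Variables a1 b1 c1 p1 q1 r1 g1 : R -> R.
Variables a2 b2 c2 p2 q2 r2 : R.
Hypotheses (Io : open I) (I0 : I 0).
Hypotheses (da : forall t, I t -> is_derive t (1 : R) a (a1 t))
  (db : forall t, I t -> is_derive t (1 : R) b (b1 t))
  (dc : forall t, I t -> is_derive t (1 : R) c (c1 t))
  (dp : forall t, I t -> is_derive t (1 : R) p (p1 t))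
  (dq : forall t, I t -> is_derive t (1 : R) q (q1 t))
  (dr : forall t, I t -> is_derive t (1 : R) r (r1 t))
  (dg : forall t, I t -> is_derive t (1 : R) g (g1 t)).
Hypotheses (da1 : is_derive (0 : R) (1 : R) a1 a2)
  (db1 : is_derive (0 : R) (1 : R) b1 b2) (dc1 : is_derive (0 : R) (1 : R) c1 c2)
  (dp1 : is_derive (0 : R) (1 : R) p1 p2) (dq1 : is_derive (0 : R) (1 : R) q1 q2)
  (dr1 : is_derive (0 : R) (1 : R) r1 r2).
Hypothesis eq0 : forall t, I t ->
  a t * b t * c t + (p t * q t * r t + p t * q t * r t)
  - a t * r t * r t - b t * q t * q t - c t * p t * p t
  = g t * (a t + b t + c t).
Hypothesis tr0 : forall t, I t -> a t + b t + c t != 0.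
Hypotheses (p0 : p 0 = 0) (q0 : q 0 = 0) (r0 : r 0 = 0).

Let D1 : R -> R := (a1 * b * c + a * b1 * c + a * b * c1)
     + (p1 * q * r + p * q1 * r + p * q * r1
        + (p1 * q * r + p * q1 * r + p * q * r1))
     - (a1 * r * r + a * r1 * r + a * r * r1)
     - (b1 * q * q + b * q1 * q + b * q * q1)
     - (c1 * p * p + c * p1 * p + c * p * p1).

Let eq1 t : I t -> D1 t = g1 t * (a t + b t + c t) + g t * (a1 t + b1 t + c1 t).
Proof.
move=> It.
have dD := is_derive_symdet (da It) (db It) (dc It) (dp It) (dq It) (dr It).
have dT := is_deriveD (is_deriveD (da It) (db It)) (dc It).
have dgT := is_deriveM (dg It) dT.
have [_ <-] : is_derive t (1 : R) (g * (a + b + c)) (D1 t).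
  apply: near_eq_is_derive dD; apply: eq_near_open Io It _ => s Is.
  exact: eq0.
have [_ ->] := dgT.
by rewrite /GRing.scale /= addrC [X in X + _ = _]mulrC.
Qed.

Let d10 : is_derive (0 : R) (1 : R) D1
  (a2 * b 0 * c 0 + a 0 * b2 * c 0 + a 0 * b 0 * c2
   + 2 * (a1 0 * b1 0 * c 0 + a1 0 * b 0 * c1 0 + a 0 * b1 0 * c1 0)
   - 2 * (c 0 * p1 0 ^+ 2 + b 0 * q1 0 ^+ 2 + a 0 * r1 0 ^+ 2)).
Proof.
have da0 := da I0; have db0 := db I0; have dc0 := dc I0.
have dp0 := dp I0; have dq0 := dq I0; have dr0 := dr I0.
have m3 (x y z x1 y1 z1 : R -> R) (x2 y2 z2 : R) :
    is_derive (0 : R) (1 : R) x (x1 0) -> is_derive (0 : R) (1 : R) y (y1 0) ->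
    is_derive (0 : R) (1 : R) z (z1 0) -> is_derive (0 : R) (1 : R) x1 x2 ->
    is_derive (0 : R) (1 : R) y1 y2 -> is_derive (0 : R) (1 : R) z1 z2 ->
  is_derive (0 : R) (1 : R) (x1 * y * z + x * y1 * z + x * y * z1)
    (x2 * y 0 * z 0 + x1 0 * y1 0 * z 0 + x1 0 * y 0 * z1 0
     + (x1 0 * y1 0 * z 0 + x 0 * y2 * z 0 + x 0 * y1 0 * z1 0)
     + (x1 0 * y 0 * z1 0 + x 0 * y1 0 * z1 0 + x 0 * y 0 * z2)).
  move=> dx dy dz dx1 dy1 dz1.
  exact: (is_deriveD (is_deriveD (is_derive_mul3 dx1 dy dz) (is_derive_mul3 dx dy1 dz))
    (is_derive_mul3 dx dy dz1)).
have := is_deriveB (is_deriveB (is_deriveB (is_deriveD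
   (m3 _ _ _ _ _ _ _ _ _ da0 db0 dc0 da1 db1 dc1)
   (is_deriveD (m3 _ _ _ _ _ _ _ _ _ dp0 dq0 dr0 dp1 dq1 dr1)
      (m3 _ _ _ _ _ _ _ _ _ dp0 dq0 dr0 dp1 dq1 dr1)))
   (m3 _ _ _ _ _ _ _ _ _ da0 dr0 dr0 da1 dr1 dr1))
   (m3 _ _ _ _ _ _ _ _ _ db0 dq0 dq0 db1 dq1 dq1))
   (m3 _ _ _ _ _ _ _ _ _ dc0 dp0 dp0 dc1 dp1 dp1).
congr (is_derive _ _ _ _); rewrite p0 q0 r0.
move: (a 0) (b 0) (c 0) (a1 0) (b1 0) (c1 0) (p1 0) (q1 0) (r1 0) => *.
by clear; ring.
Qed.

Lemma det_equation_first :
  b 0 * c 0 * a1 0 + a 0 * c 0 * b1 0 + a 0 * b 0 * c1 0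
  = g1 0 * (a 0 + b 0 + c 0) + g 0 * (a1 0 + b1 0 + c1 0).
Proof.
rewrite -eq1 // -[D1 0]/((a1 0 * b 0 * c 0 + a 0 * b1 0 * c 0 + a 0 * b 0 * c1 0)
     + (p1 0 * q 0 * r 0 + p 0 * q1 0 * r 0 + p 0 * q 0 * r1 0
        + (p1 0 * q 0 * r 0 + p 0 * q1 0 * r 0 + p 0 * q 0 * r1 0))
     - (a1 0 * r 0 * r 0 + a 0 * r1 0 * r 0 + a 0 * r 0 * r1 0)
     - (b1 0 * q 0 * q 0 + b 0 * q1 0 * q 0 + b 0 * q 0 * q1 0)
     - (c1 0 * p 0 * p 0 + c 0 * p1 0 * p 0 + c 0 * p 0 * p1 0)).
rewrite p0 q0 r0.
move: (a 0) (b 0) (c 0) (a1 0) (b1 0) (c1 0) (p1 0) (q1 0) (r1 0) => *.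
by clear; ring.
Qed.

Lemma det_equation_second : exists2 g2 : R, is_derive (0 : R) (1 : R) g1 g2 &
  b 0 * c 0 * a2 + a 0 * c 0 * b2 + a 0 * b 0 * c2
  + 2 * (c 0 * a1 0 * b1 0 + b 0 * a1 0 * c1 0 + a 0 * b1 0 * c1 0)
  - 2 * (c 0 * p1 0 ^+ 2 + b 0 * q1 0 ^+ 2 + a 0 * r1 0 ^+ 2)
  = g2 * (a 0 + b 0 + c 0) + 2 * g1 0 * (a1 0 + b1 0 + c1 0) + g 0 * (a2 + b2 + c2).
Proof.
have dT := is_deriveD (is_deriveD (da I0) (db I0)) (dc I0).
have dT1 := is_deriveD (is_deriveD da1 db1) dc1.
have dgT1 := is_deriveM (dg I0) dT1.
have T0 := tr0 I0.
have dg1 : derivable g1 (0 : R) (1 : R).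
  have : derivable ((D1 - g * (a1 + b1 + c1)) * (fun t => ((a + b + c) t)^-1))
      (0 : R) (1 : R).
    apply: derivableM; last by apply: derivableV => //; exact: ex_derive.
    by apply: derivableB; [have [] := d10|have [] := dgT1].
  apply: near_eq_derivable; apply: eq_near_open Io I0 _ => t It.
  rewrite -[LHS]/((D1 t - g t * (a1 t + b1 t + c1 t)) / (a t + b t + c t)) eq1 //.
  by rewrite addrK mulfK // tr0.
exists ('D_1 g1 0); first exact: derivableP.
have dg1T := is_deriveM (derivableP dg1) dT.
have E : is_derive (0 : R) (1 : R) D1 _ := near_eq_is_derive
  (eq_near_open Io I0 (fun t It => esym (eq1 It))) (is_deriveD dg1T dgT1).
have [_ E1] := d10; have [_] := E; rewrite E1 /GRing.scale /=.
rewrite -[(a + b + c) 0]/(a 0 + b 0 + c 0) -[(a1 + b1 + c1) 0]/(a1 0 + b1 0 + c1 0).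
move: (a 0) (b 0) (c 0) (a1 0) (b1 0) (c1 0) (p1 0) (q1 0) (r1 0) (g 0) (g1 0) ('D_1 g1 0).
move=> xa xb xc xa1 xb1 xc1 xp1 xq1 xr1 xg xg1 xg2 H.
by apply: (eq_trans _ (eq_trans H _)); clear; ring.
Qed.
End det_equation.

(** * The right-hand side f(x, u(x)) *)

(** The function f is differentiated along the graph of u over a line with
direction q.  The factor k = n + 1 comes from bounding a directional derivative of
f by the sum of the absolute values of its n + 1 partial derivatives. *)
Section right_hand_side.
Variables (R : realType) (n : nat) (f : 'rV[R]_n -> R -> R) (u : 'rV[R]_n -> R).
Variables (r r' M : R) (x q : 'rV[R]_n).

Let B' := @eball R n r'.
Let S := @ecball R n r.
Let K := cyl S `[- M, M].
Let L := normC01 S u.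
Let N := normC11 K (joint f).
Let k : R := (n + 1)%:R.

Hypotheses (rr : r < r') (Cf : C11 (cyl B' setT) (joint f)) (Cu : Ck 2 B' u).
Hypotheses (uM : supnorm S u <= M) (xr : eball r x) (q1 : enorm q = 1).

Let graph (y : 'rV[R]_n) : 'rV[R]_(n + 1) := row_mx y (const_mx (u y)).
Let hor : 'rV[R]_(n + 1) := row_mx q 0.
Let ver : 'rV[R]_(n + 1) := row_mx 0 (const_mx 1).
Let line (t : R) := x + t *: q.

(** The derivative of t |-> f(x + t q, u(x + t q)), that is f_q + u_q f_t along the
graph of u, as a function of t. *)
Definition rhs_derive (t : R) : R :=
  'D_hor (joint f) (graph (line t)) + 'D_q u (line t) * 'D_ver (joint f) (graph (line t)).

Let Bo : open B'. Proof. exact: eball_open. Qed.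
Let Co : open (cyl B' [set: R]). Proof. exact: cyl_open. Qed.
Let Cf1 : Ck 1 (cyl B' setT) (joint f). Proof. by case: Cf. Qed.
Let Cu1 : Ck 1 B' u. Proof. exact: CkW. Qed.

Lemma joint_graph y : joint f (graph y) = f y (u y).
Proof. by rewrite /joint /graph row_mxKl row_mxKr mxE. Qed.

Let graph_cyl y : B' y -> cyl B' setT (graph y).
Proof. by move=> By; rewrite /cyl /= /graph row_mxKl. Qed.

(** [is_derive_curve] with the horizontal line as x + t a and the increment of u
as s. *)
Lemma is_derive_rhs t : B' (line t) ->
  is_derive t (1 : R) (fun s => f (line s) (u (line s))) (rhs_derive t).
Proof.
move=> Bt; have pt := graph_cyl Bt.
have dh := derivableP (Ck_derivable (v := hor) Co Cf1 pt).
have nv : \forall z \near graph (line t), derivable (joint f) z ver.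
  have : nbhs (graph (line t)) (cyl B' setT) by exact: open_nbhs_nbhs.
  by apply: filterS => z Cz; exact: (Ck_derivable (v := ver) Co Cf1 Cz).
have cv : {for graph (line t), continuous ('D_ver (joint f))}.
  exact: (Ck_continuous (Ck_derive ver Co Cf1) pt).
pose s (h : R) := u (line t + h *: q) - u (line t).
have s0 : s 0 = 0 by rewrite /s scale0r addr0 subrr.
have ds : is_derive (0 : R) (1 : R) s ('D_q u (line t)).
  have := is_deriveB (is_derive_along0 q Bo Cu1 Bt)
    (is_derive_cst (u (line t)) (0 : R) (1 : R)).
  by rewrite subr0.
have /is_derive_quotientP H := is_derive_curve dh nv cv s0 ds.
apply/is_derive_quotientP; move: H.
have E h : graph (line t) + h *: hor + s h *: ver = graph (line (t + h)).
  rewrite /graph /hor /ver !scale_row_mx !add_row_mx; congr row_mx.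
    by rewrite scaler0 addr0 /line scalerDl addrA.
  apply/matrixP => i j; rewrite !mxE mulr0 addr0 mulr1 /s addrCA.
  by rewrite subrr addr0 /line scalerDl addrA.
have -> : (fun h : R => h^-1 * (joint f (graph (line t) + (0 + h *: (1 : R)) *: hor
      + s (0 + h *: (1 : R)) *: ver)
    - joint f (graph (line t) + 0 *: hor + s 0 *: ver))) =
  (fun h : R => h^-1 * (f (line (t + h *: (1 : R))) (u (line (t + h *: (1 : R))))
    - f (line t) (u (line t)))).
  by apply/funext => h; rewrite !E add0r addr0 !joint_graph.
by [].
Qed.

Let xS : S x. Proof. exact: ltW. Qed.

Let u_le y : S y -> `|u y| <= M.
Proof.
move=> Sy; apply: le_trans uM; apply: supnorm_ub => //; first exact: ecball_compact.
by move=> z Sz; apply: (Ck_continuous Cu1); exact: eball_ecball rr Sz.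
Qed.

Lemma graph_in_cyl y : S y -> K (graph y).
Proof.
move=> Sy; split; first by rewrite /graph row_mxKl.
by rewrite /graph row_mxKr mxE /= in_itv /= -ler_norml u_le.
Qed.

Let cK : compact K. Proof. exact: cyl_compact. Qed.
Let KU : K `<=` cyl B' setT.
Proof. by move=> p [pr _]; split=> //; exact: eball_ecball rr pr. Qed.

Let L_ge0 : 0 <= L. Proof. by rewrite addr_ge0 ?supnorm_ge0 ?lipnorm_ge0. Qed.
Let N_ge0 : 0 <= N.
Proof.
by rewrite !addr_ge0 ?supnorm_ge0 ?lipnorm_ge0 // => *; exact: enorm_ge0.
Qed.
Let k_ge0 : 0 <= k. Proof. by rewrite ler0n. Qed.

Let dirE (v p : 'rV[R]_(n + 1)) : K p ->
  'D_v (joint f) p = \sum_j v 0 j * partial 1%:M j (joint f) p.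
Proof. by move=> /KU Cp; have [_ ->] := C1_is_derive v Co Cf1 Cp. Qed.

Let sum_const (c : R) : \sum_(j < n + 1) c = k * c.
Proof. by rewrite sumr_const card_ord mulr_natl. Qed.

Let dir_le (v p : 'rV[R]_(n + 1)) : (forall j, `|v 0 j| <= 1) -> K p ->
  `|'D_v (joint f) p| <= k * N.
Proof.
move=> v1 Kp; rewrite dirE // -sum_const.
apply: le_trans (ler_norm_sum _ _ _) _; apply: ler_sum => j _.
rewrite normrM -[leRHS]mul1r; apply: ler_pM => //.
exact: (partial_le_normC11 cK KU Cf).
Qed.

Let dir_lip (v p p' : 'rV[R]_(n + 1)) : (forall j, `|v 0 j| <= 1) -> K p -> K p' ->
  `|'D_v (joint f) p - 'D_v (joint f) p'| <= k * (N * enorm (p - p')).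
Proof.
move=> v1 Kp Kp'; rewrite !dirE // -sumrB -sum_const.
apply: le_trans (ler_norm_sum _ _ _) _; apply: ler_sum => j _.
rewrite -mulrBr normrM -[leRHS]mul1r; apply: ler_pM => //.
exact: (partial_lip_normC11 cK KU Cf).
Qed.

Let hor1 j : `|hor 0 j| <= 1.
Proof.
rewrite /hor; case: (split_ordP j) => i ->; last by rewrite row_mxEr mxE normr0 ler01.
by rewrite row_mxEl -q1; exact: coord_le_enorm.
Qed.

Let ver1 j : `|ver 0 j| <= 1.
Proof.
rewrite /ver; case: (split_ordP j) => i ->.
  by rewrite row_mxEl mxE normr0 ler01.
by rewrite row_mxEr mxE normr1.
Qed.

Let line0 : line 0 = x. Proof. by rewrite /line scale0r addr0. Qed.

Let graph_lip t : S (line t) ->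
  enorm (graph (line t) - graph x) <= (k + L) * `|t|.
Proof.
move=> St; apply: le_trans (enorm_le_sum _) _.
have E : line t - x = t *: q by rewrite /line addrC addKr.
have -> : graph (line t) - graph x = row_mx (t *: q) (const_mx (u (line t) - u x)).
  rewrite /graph opp_row_mx add_row_mx E; congr row_mx.
  by apply/matrixP => i j; rewrite !mxE.
rewrite big_split_ord /= big_ord1 mulrDl; apply: lerD; last first.
  rewrite row_mxEr mxE; apply: le_trans (lip_normC01 rr Cu1 St xS) _.
  by rewrite E enormZ q1 mulr1.
apply: (@le_trans _ _ (\sum_(i < n) `|t|)).
  apply: ler_sum => i _; rewrite row_mxEl mxE normrM.
  by rewrite ler_piMr // -q1 coord_le_enorm.
rewrite sumr_const card_ord -mulr_natl ler_wpM2r // ler_nat leq_addr //.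
Qed.

Lemma rhs_derive_le : `|rhs_derive 0| <= k * N * (1 + L).
Proof.
have Kx := graph_in_cyl xS; rewrite /rhs_derive line0.
apply: le_trans (ler_normD _ _) _; rewrite mulrDr mulr1.
apply: lerD; first exact: dir_le.
rewrite normrM mulrC; apply: ler_pM => //; first exact: dir_le.
exact: derive_le_normC01 rr Cu1 xr q1.
Qed.

(** Up to f_t u_qq, the difference quotient of [rhs_derive] only involves
increments of the gradient of f along the graph of u, which are bounded by its
Lipschitz constant although the gradient need not be differentiable. *)
Lemma rhs_derive2_ge g2 : is_derive (0 : R) (1 : R) rhs_derive g2 ->
  0 <= 'D_q ('D_q u) x ->
  - (k * N * (k + L) * (1 + L)) - k * N * 'D_q ('D_q u) x <= g2.
Proof.
have combine (a b e g : R) : - a <= g - b -> - e <= b -> - a - e <= g by lra.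
move=> dg2 uqq; have Bx : B' x := eball_ecball rr xS; have Kx := graph_in_cyl xS.
pose c := 'D_ver (joint f) (graph x).
have du1 := is_derive_along0 q Bo (Ck_derive q Bo Cu) Bx.
have d := is_deriveB dg2 (is_deriveZ c du1).
have H : `|g2 - c *: 'D_q ('D_q u) x| <= k * N * (k + L) * (1 + L).
  apply: is_derive_le d _.
  have : \forall t \near (0 : R), eball r (x + t *: q).
    by apply: near_line_open xr; exact: eball_open.
  apply: filterS => t xt; rewrite add0r [t *: 1]mulr1.
  have St : S (line t) by exact: ltW.
  have Kt := graph_in_cyl St.
  rewrite -![(_ - _) _]/(_ - _) -![(c \*: _) _]/(_ * _) /rhs_derive line0 -/(line t).
  rewrite scale0r addr0 -/c.
  have -> : 'D_hor (joint f) (graph (line t)) +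
     'D_q u (line t) * 'D_ver (joint f) (graph (line t)) - c * 'D_q u (line t) -
     ('D_hor (joint f) (graph x) + 'D_q u x * c - c * 'D_q u x) =
     ('D_hor (joint f) (graph (line t)) - 'D_hor (joint f) (graph x)) +
     ('D_ver (joint f) (graph (line t)) - c) * 'D_q u (line t).
    move: ('D_hor _ _) ('D_hor _ _) ('D_ver _ _) ('D_q u _) ('D_q u _) c => *.
    by clear; ring.
  have lip (v : 'rV[R]_(n + 1)) : (forall j, `|v 0 j| <= 1) ->
     `|'D_v (joint f) (graph (line t)) - 'D_v (joint f) (graph x)| <=
     k * N * (k + L) * `|t|.
    move=> v1; apply: le_trans (dir_lip v1 Kt Kx) _.
    by rewrite -!mulrA; do 2 apply: ler_wpM2l => //; exact: graph_lip.
  apply: le_trans (ler_normD _ _) _; rewrite mulrDr mulr1 mulrDl.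
  apply: lerD; first exact: lip hor1.
  rewrite normrM mulrAC; apply: ler_pM => //; first exact: lip ver1.
  exact: derive_le_normC01 rr Cu1 xt q1.
have cN : c * 'D_q ('D_q u) x >= - (k * N * 'D_q ('D_q u) x).
  rewrite -mulNr; apply: ler_wpM2r => //.
  by have := dir_le ver1 Kx; rewrite ler_norml => /andP[].
move: H; rewrite ler_norml => /andP[H _].
exact: combine H cN.
Qed.

End right_hand_side.

(** * The operator in a rotated frame *)

(** The perturbed matrices are symmetric, so F is det / tr along the line, a
quotient of affine functions. *)
Lemma Fdiag_affine (R : realType) (A : 'M[R]_3) i (P c : R) :
  A^T = A -> (forall h, \det (A + h *: delta_mx i i) = P + h * c) -> \tr A != 0 ->
  Fdiag A i = (c - P / \tr A) / \tr A.
Proof.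
have alg (s y z : R) : s != 0 -> z * (- s ^- 2 * 1) + s^-1 * y = (y - z / s) / s.
  by move=> s0; field.
move=> As detA tr0.
have FE h : F (A + h *: delta_mx i i) = (P + h * c) * (\tr A + h)^-1.
  rewrite F_sym ?detA; last by rewrite linearD linearZ /= As trmx_delta.
  rewrite mxtraceD mxtraceZ; suff -> : \tr (delta_mx i i : 'M[R]_3) = 1 by rewrite mulr1.
  rewrite /mxtrace (bigD1 i) //= big1 ?addr0; first by rewrite mxE eqxx.
  by move=> j /negbTE ji; rewrite mxE ji.
suff [_ E] : is_derive A (delta_mx i i) (@F R) ((c - P / \tr A) / \tr A) by exact: E.
rewrite -{1}[A]addr0 -(scale0r (delta_mx i i)); apply/is_derive_line.
have -> : (fun s : R => F (A + s *: delta_mx i i)) =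
   (cst P + c \*: (id : R -> R)) * (fun h => (\tr A + h)^-1).
  by apply/funext => h; rewrite FE [h * c]mulrC.
have dn : is_derive (0 : R) (1 : R) (cst P + c \*: (id : R -> R)) c.
  by apply: is_derive_eq; rewrite add0r [LHS]mulr1.
have dt : is_derive (0 : R) (1 : R) (cst (\tr A) + (id : R -> R)) 1.
  by apply: is_derive_eq; rewrite add0r.
have T0 : (cst (\tr A) + (id : R -> R)) 0 = \tr A by rewrite -[LHS]/(_ + 0) addr0.
have dV : is_derive (0 : R) (1 : R) (fun h => (\tr A + h)^-1) (- (\tr A) ^- 2 *: (1 : R)).
  apply: DeriveDef.
    by apply: (@derivableV _ _ (cst (\tr A) + (id : R -> R))); rewrite ?T0.
  rewrite (@deriveV _ _ (cst (\tr A) + (id : R -> R))) ?T0 //.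
  by congr (_ *: _); exact: derive_val.
have := is_deriveM dn dV; congr (is_derive _ _ _ _).
rewrite -[(cst P + _) 0]/(P + c * 0) mulr0 !addr0 /GRing.scale /=; exact: alg.
Qed.

Local Notation o0 := (ord0 : 'I_3).
Local Notation o1 := (lift ord0 ord0 : 'I_3).
Local Notation o2 := (lift ord0 (lift ord0 ord0) : 'I_3).

Section rotation.
Variables (R : realType) (n : nat) (U : set 'rV[R]_n) (g : 'rV[R]_n -> R).
Variables (Q : 'M[R]_n) (x : 'rV[R]_n).
Hypotheses (Uo : open U) (Cg : Ck 2 U g) (Ux : U x) (Qorth : Q *m Q^T = 1%:M).

Lemma hess_sym : (hess Q g x)^T = hess Q g x.
Proof. by apply/matrixP => i j; rewrite !mxE; exact: (derive_comm _ _ Uo Cg Ux). Qed.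

Lemma hess_rotate : hess Q g x = Q *m hess 1%:M g x *m Q^T.
Proof.
apply/matrixP => i j; rewrite mxE [LHS](derive2E _ _ Uo Cg Ux).
by rewrite -row_mul mxE [RHS]mxE; apply: eq_bigr => k _; rewrite !mxE.
Qed.

Lemma det_hess_rotate : \det (hess Q g x) = \det (hess 1%:M g x).
Proof.
by rewrite hess_rotate !det_mulmx mulrAC -det_mulmx Qorth det1 mul1r.
Qed.

Lemma tr_hess_rotate : \tr (hess Q g x) = \tr (hess 1%:M g x).
Proof. by rewrite hess_rotate mxtrace_mulC mulmxA (mulmx1C Qorth) mul1mx. Qed.

End rotation.

Lemma row_orthonormal (R : realType) n (Q : 'M[R]_n) i :
  Q *m Q^T = 1%:M -> row i Q *m (row i Q)^T = 1%:M.
Proof.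
move=> QQ; apply/matrixP => a b; rewrite !ord1.
have := congr1 (fun A : 'M[R]_n => A i i) QQ; rewrite mxE [RHS]mxE eqxx => H.
rewrite mxE [RHS]mxE eqxx -[RHS]H; apply: eq_bigr => k _.
by rewrite !mxE.
Qed.

Lemma enorm_row (R : realType) n (Q : 'M[R]_n) i :
  Q *m Q^T = 1%:M -> enorm (row i Q) = 1.
Proof.
move=> /(row_orthonormal i) E.
have H : (row i Q *m (row i Q)^T) 0 0 = 1 by rewrite E mxE eqxx.
rewrite /enorm -[RHS]sqrtr1 -H mxE; congr Num.sqrt.
by apply: eq_bigr => k _; rewrite !mxE expr2.
Qed.

Lemma sum3 (R : nmodType) (G : 'I_3 -> R) : \sum_i G i = G o0 + G o1 + G o2.
Proof. by rewrite !big_ord_recl big_ord0 addr0 addrA. Qed.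

Lemma Fdiag_diag (R : realType) (d : 'rV[R]_3) i (s := \sum_k d 0 k) : s != 0 ->
  Fdiag (diag_mx d) i = (\prod_(k | k != i) d 0 k - (\prod_k d 0 k) / s) / s.
Proof.
move=> s0.
have trA : \tr (diag_mx d) = s.
  by apply: eq_bigr => k _; rewrite mxE eqxx mulr1n.
rewrite -trA; apply: Fdiag_affine; rewrite ?tr_diag_mx ?trA // => h.
have -> : diag_mx d + h *: delta_mx i i = diag_mx (d + h *: delta_mx 0 i).
  apply/matrixP => j k; rewrite !mxE; have [->|jk] := eqVneq j k.
    by rewrite !mulr1n eqxx /= andbb.
  rewrite !mulr0n add0r; case: eqP => [<-|_] /=; last by rewrite mulr0.
  by rewrite eq_sym (negbTE jk) mulr0.
rewrite det_diag (bigD1 i) //= [in RHS](bigD1 i) //= !mxE !eqxx mulr1 -mulrDl.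
congr (_ * _); by apply: eq_bigr => k /negbTE ki; rewrite !mxE ki mulr0 addr0.
Qed.

Lemma Fdiag_diag3 (R : realType) (d : 'rV[R]_3) (s := d 0 o0 + d 0 o1 + d 0 o2)
    (f := d 0 o0 * d 0 o1 * d 0 o2 / s) : s != 0 ->
  [/\ Fdiag (diag_mx d) o0 = (d 0 o1 * d 0 o2 - f) / s,
      Fdiag (diag_mx d) o1 = (d 0 o0 * d 0 o2 - f) / s
    & Fdiag (diag_mx d) o2 = (d 0 o0 * d 0 o1 - f) / s].
Proof.
rewrite /f /s -sum3 => s0; split; rewrite Fdiag_diag //;
  by rewrite !big_mkcond /= !big_ord_recl !big_ord0 /= ?mul1r ?mulr1 ?mulrA.
Qed.

(** The derivatives along v1 of u_12, u_13, u_22, u_33 are rewritten by symmetry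
as derivatives of u_11 along the other directions, the form in which the test
function controls them. *)
Lemma differentiated_equation (R : realType) (n : nat) (B : set 'rV[R]_n)
    (u h : 'rV[R]_n -> R) (h1 : R -> R) (x v1 v2 v3 : 'rV[R]_n)
    (D := fun v w => 'D_w ('D_v u)) (a := D v1 v1) :
  open B -> Ck 4 B u -> B x ->
  (forall t, B (x + t *: v1) ->
     is_derive t (1 : R) (fun s => h (x + s *: v1)) (h1 t)) ->
  (forall y, B y ->
     D v1 v1 y * D v2 v2 y * D v3 v3 y
     + (D v1 v2 y * D v1 v3 y * D v2 v3 y + D v1 v2 y * D v1 v3 y * D v2 v3 y)
     - D v1 v1 y * D v2 v3 y * D v2 v3 y - D v2 v2 y * D v1 v3 y * D v1 v3 y
     - D v3 v3 y * D v1 v2 y * D v1 v2 y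
     = h y * (D v1 v1 y + D v2 v2 y + D v3 v3 y)) ->
  (forall y, B y -> D v1 v1 y + D v2 v2 y + D v3 v3 y != 0) ->
  D v1 v2 x = 0 -> D v1 v3 x = 0 -> D v2 v3 x = 0 ->
  let l1 := D v1 v1 x in let l2 := D v2 v2 x in let l3 := D v3 v3 x in
  let a1 := 'D_v1 a x in let b1 := 'D_v1 (D v2 v2) x in let c1 := 'D_v1 (D v3 v3) x in
  let p1 := 'D_v2 a x in let q1 := 'D_v3 a x in let r1 := 'D_v1 (D v2 v3) x in
  let a2 := 'D_v1 ('D_v1 a) x in let b2 := 'D_v2 ('D_v2 a) x in
  let c2 := 'D_v3 ('D_v3 a) x in
  l2 * l3 * a1 + l1 * l3 * b1 + l1 * l2 * c1
    = h1 0 * (l1 + l2 + l3) + h x * (a1 + b1 + c1) /\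
  exists2 g2 : R, is_derive (0 : R) (1 : R) h1 g2 &
    l2 * l3 * a2 + l1 * l3 * b2 + l1 * l2 * c2
      + 2 * (l3 * a1 * b1 + l2 * a1 * c1 + l1 * b1 * c1)
      - 2 * (l3 * p1 ^+ 2 + l2 * q1 ^+ 2 + l1 * r1 ^+ 2)
    = g2 * (l1 + l2 + l3) + 2 * h1 0 * (a1 + b1 + c1) + h x * (a2 + b2 + c2).
Proof.
have val_eq (g : R -> R) (t c d : R) :
  is_derive t (1 : R) g c -> c = d -> is_derive t (1 : R) g d by move=> H <-.
move=> Bo Cu Bx dh eqB trB D12 D13 D23 l1 l2 l3 a1 b1 c1 p1 q1 r1 a2 b2 c2.
pose line t := x + t *: v1.
pose I := line @^-1` B.
have Io : open I.
  apply: open_comp => // t _; apply: (@cvgD _ _ _ _ _ (cst x)); first exact: cvg_cst.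
  by apply: cvgZr_tmp; exact: cvg_id.
have line0 : line 0 = x by rewrite /line scale0r addr0.
have I0 : I 0 by rewrite /I /= line0.
have CD v w : Ck 2 B (D v w) := Ck_derive w Bo (Ck_derive v Bo Cu).
have C1 : Ck 2 B ('D_v1 u) := CkW (Ck_derive v1 Bo Cu).
have dD v w t : I t ->
    is_derive t (1 : R) (fun s => D v w (line s)) ('D_v1 (D v w) (line t)).
  by move=> It; exact: (is_derive_along Bo (CD v w) It).
have dD1 v w : is_derive (0 : R) (1 : R) (fun t => 'D_v1 (D v w) (line t))
    ('D_v1 ('D_v1 (D v w)) x).
  exact: (is_derive_along0 _ Bo (Ck_derive v1 Bo (CD v w)) Bx).
have dD1w w t : I t -> is_derive t (1 : R) (fun s => D v1 w (line s)) ('D_w a (line t)).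
  by move=> It; exact: (val_eq _ _ _ _ (dD v1 w t It) (derive_comm v1 w Bo C1 It)).
have daw w : is_derive (0 : R) (1 : R) (fun t => 'D_w a (line t)) ('D_v1 ('D_w a) x).
  exact: (is_derive_along0 _ Bo (Ck_derive w Bo (CD v1 v1)) Bx).
have dDww w : is_derive (0 : R) (1 : R) (fun t => 'D_v1 (D w w) (line t))
    ('D_w ('D_w a) x).
  exact: (val_eq _ _ _ _ (dD1 w w) (derive_comm4 v1 w Bo Cu Bx)).
have p0 : D v1 v2 (line 0) = 0 by rewrite line0.
have q0 : D v1 v3 (line 0) = 0 by rewrite line0.
have r0 : D v2 v3 (line 0) = 0 by rewrite line0.
have eqI t (It : I t) := eqB (line t) It.
have trI t (It : I t) := trB (line t) It.
have dhl t : I t -> is_derive t (1 : R) (fun s => h (line s)) (h1 t) by exact: dh.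
have E1 := det_equation_first Io I0 (dD v1 v1) (dD v2 v2) (dD v3 v3) (dD1w v2)
  (dD1w v3) (dD v2 v3) dhl eqI p0 q0 r0.
have [g2 dg2 E2] := det_equation_second Io I0 (dD v1 v1) (dD v2 v2) (dD v3 v3)
  (dD1w v2) (dD1w v3) (dD v2 v3) dhl (dD1 v1 v1) (dDww v2) (dDww v3) (daw v2) (daw v3)
  (dD1 v2 v3) eqI trI p0 q0 r0.
rewrite line0 in E1 E2.
by split; [exact: E1|exists g2; [exact: dg2|exact: E2]].
Qed.

(** L, m, N are the C^{0,1} norm of u, the minimum of f and the C^{1,1} norm of f.  The three terms come from 5 g_1^2 / (f lambda_1), from the part of g_11
that does not involve u_11, and from f_t u_11 / lambda_1; the 4 is the number of
variables of f. *)
Definition jacobi_constant (R : realFieldType) (L m N : R) : R :=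
  5 * ((4 * N * (1 + L)) ^+ 2 / m) + 4 * N * (4 + L) * (1 + L) + 4 * N.

Lemma jacobi_constant_ge (R : realFieldType) (L m N l f g1 g2 : R) :
  0 <= L -> 0 <= N -> 0 < m -> m <= f -> 1 <= l ->
  `|g1| <= 4 * N * (1 + L) ->
  - (4 * N * (4 + L) * (1 + L)) - 4 * N * l <= g2 ->
  - jacobi_constant L m N <= g2 / l - 5 * (g1 ^+ 2 / (f * l)).
Proof.
move=> L0 N0 m0 mf l1; rewrite /jacobi_constant.
set G := 4 * N * (1 + L); set A := 4 * N * (4 + L) * (1 + L) => gG g2A.
have l0 : 0 < l by apply: lt_le_trans l1.
have A0 : 0 <= A by rewrite !mulr_ge0 ?addr_ge0.
have f0 : 0 < f by apply: lt_le_trans mf.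
have H1 : g1 ^+ 2 / (f * l) <= G ^+ 2 / m.
  have gG2 : g1 ^+ 2 <= G ^+ 2.
    by rewrite -(real_normK (num_real g1)) lerXn2r // nnegrE // (le_trans _ gG).
  apply: ler_pM => //; first exact: sqr_ge0.
    by rewrite invr_ge0 mulr_ge0 // ltW.
  rewrite lef_pV2 ?posrE ?mulr_gt0 //; apply: le_trans mf _.
  by rewrite ler_peMr // ltW.
have H2 : - A - 4 * N <= g2 / l.
  rewrite ler_pdivlMr //; apply: le_trans g2A; rewrite mulrBl lerD2r.
  by rewrite mulNr lerN2 ler_peMr.
move: H1 H2; move: (_ / _) (_ / _) (_ / _) => *; lra.
Qed.

Theorem lemma3p1 (R : realType) :
  exists (Lambda : R -> R) (C : R -> R -> R -> R),
  forall (f : 'rV[R]_3 -> R -> R) (u : 'rV[R]_3 -> R) (M : R),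
    C11 (cyl (eball 10) setT) (joint f) ->
    (forall x t, eball 10 x -> 0 < f x t) ->
    Ck 4 (eball 10) u ->
    convex_function (eball 10) u ->
    (forall x, eball 10 x -> F (hess 1%:M u x) = f x (u x)) ->
    supnorm (ecball 9) u <= M ->
    let K := cyl (ecball 9) `[- M, M] in
    let maxf := sup [set joint f p | p in K] in
    let minf := inf [set joint f p | p in K] in
    let C0 := C (normC01 (ecball 9) u) minf (normC11 K (joint f)) in
    let b := fun x => ln (lambda 0 (hess 1%:M u x)) in
    forall (x0 : 'rV[R]_3) (Q : 'M[R]_3),
      eball 9 x0 ->
      Q *m Q^T = 1%:M ->
      hess Q u x0 = diag_mx (\row_i lambda i (hess 1%:M u x0)) ->
      Lambda maxf <= lambda 0 (hess 1%:M u x0) ->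
      forall phi : 'rV[R]_3 -> R, touches_above phi b x0 ->
        \sum_i Fdiag (hess Q u x0) i * hess Q phi x0 i i >=
          1 / 432 * (\sum_i Fdiag (hess Q u x0) i * grad Q phi x0 0 i ^+ 2)
          - C0.
Proof.
exists (fun=> 1), (@jacobi_constant R).
have ln_le (y z : R) : 0 < y -> 0 < z -> y <= z -> ln y <= ln z.
  by move=> y0 z0 yz; rewrite ler_ln ?posrE.
have combine (c y z : R) : - c <= y - z -> z - c <= y by lra.
move=> f u M Cf fpos Cu ucvx Feq uM K maxf minf C0 b x0 Q x0r QQ Hdiag l1_ge1 phi touch.
set B := @eball R 3 10.
have Bo : open B by exact: eball_open.
have r910 : (9 : R) < 10 by rewrite ltr_nat.
have xB : B x0 by exact: lt_trans r910.
have xS : ecball 9 x0 by exact: ltW.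
have C2 : Ck 2 B u := CkW (CkW Cu).
pose e i := row i Q.
pose H i j := 'D_(e j) ('D_(e i) u).
have CH i j : Ck 2 B (H i j).
  exact: (Ck_derive (e j) Bo (Ck_derive (e i) Bo Cu)).
have Hsym i j x : B x -> H i j x = H j i x.
  by move=> Bx; exact: (derive_comm (e j) (e i) Bo C2 Bx).
have e1 i : enorm (e i) = 1 by exact: enorm_row.
set A := hess 1%:M u x0 in Hdiag l1_ge1 *.
have hsym x : B x -> (hess 1%:M u x)^T = hess 1%:M u x.
  by move=> Bx; exact: (hess_sym _ Bo C2 Bx).
have As : A^T = A by exact: hsym.
pose l i := lambda i A.
have HE i j : H i j x0 = (l i) *+ (i == j).
  by have := congr1 (fun X : 'M[R]_3 => X i j) Hdiag; rewrite !mxE.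
have l10 : l 1%N <= l 0%N by apply: lambda_le.
have l21 : l 2%N <= l 1%N by apply: lambda_le.
have Heq x : B x ->
    \det (hess Q u x) = f x (u x) * \tr (hess Q u x) /\ \tr (hess Q u x) != 0.
  move=> Bx; rewrite (det_hess_rotate Bo C2 Bx QQ) (tr_hess_rotate Bo C2 Bx QQ).
  have := Feq x Bx; rewrite F_sym; last exact: hsym.
  have := fpos x (u x) Bx; set D := \det _; set T := \tr _ => f0 fE.
  have T0 : T != 0.
    by apply: contraTneq f0 => T0; rewrite -fE T0 invr0 mulr0 ltxx.
  by split=> //; rewrite -fE mulfVK.
have L0 : 0 <= normC01 (ecball 9) u by rewrite addr_ge0 ?supnorm_ge0 ?lipnorm_ge0.
have N0 : 0 <= normC11 K (joint f).
  by rewrite !addr_ge0 ?supnorm_ge0 ?lipnorm_ge0 // => *; exact: enorm_ge0.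
have trQ x : \tr (hess Q u x) = H o0 o0 x + H o1 o1 x + H o2 o2 x.
  by rewrite /mxtrace sum3 !mxE.
have H00 : H o0 o0 x0 = l 0%N by rewrite HE.
have H11 : H o1 o1 x0 = l 1%N by rewrite HE.
have H22 : H o2 o2 x0 = l 2%N by rewrite HE.
have H01 : H o0 o1 x0 = 0 by rewrite HE.
have H02 : H o0 o2 x0 = 0 by rewrite HE.
have H12 : H o1 o2 x0 = 0 by rewrite HE.
have detQ x : B x -> \det (hess Q u x) =
    H o0 o0 x * H o1 o1 x * H o2 o2 x
    + (H o0 o1 x * H o0 o2 x * H o1 o2 x + H o0 o1 x * H o0 o2 x * H o1 o2 x)
    - H o0 o0 x * H o1 o2 x * H o1 o2 x - H o1 o1 x * H o0 o2 x * H o0 o2 x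
    - H o2 o2 x * H o0 o1 x * H o0 o1 x.
  have hE i j : hess Q u x i j = H i j x by rewrite mxE.
  move=> Bx; rewrite det3 !hE.
  rewrite (Hsym o1 o0 x Bx) (Hsym o2 o0 x Bx) (Hsym o2 o1 x Bx).
  move: (H o0 o0 x) (H o1 o1 x) (H o2 o2 x) (H o0 o1 x) (H o0 o2 x) (H o1 o2 x).
  by clear; move=> *; ring.
have [eqx trx] := Heq x0 xB.
set fx := f x0 (u x0) in eqx.
have fx0 : 0 < fx by exact: fpos.
(* Convexity only gives nonnegative eigenvalues; their product is f tr, hence
   positive. *)
have l2_ge0 : 0 <= l 2%N.
  by rewrite -H22; exact: (convex_second_derivative (e o2) Bo C2 ucvx xB).
set s := l 0%N + l 1%N + l 2%N.
have s0 : 0 < s.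
  rewrite /s; have := lexx (l 0%N); move: l1_ge1 l10 l21 l2_ge0; rewrite -/(l 0%N).
  by move: (l 0%N) (l 1%N) (l 2%N); clear => *; lra.
have lll : l 0%N * l 1%N * l 2%N = fx * s.
  move: eqx; rewrite detQ // trQ H00 H11 H22 H01 H02 H12 => <-.
  by rewrite !(mulr0, subr0, addr0).
have l2_gt0 : 0 < l 2%N.
  rewrite lt_neqAle l2_ge0 andbT; apply/eqP => l20.
  by have := mulr_gt0 fx0 s0; rewrite -lll -l20 mulr0 ltxx.
have eqB y : B y -> H o0 o0 y * H o1 o1 y * H o2 o2 y
    + (H o0 o1 y * H o0 o2 y * H o1 o2 y + H o0 o1 y * H o0 o2 y * H o1 o2 y)
    - H o0 o0 y * H o1 o2 y * H o1 o2 y - H o1 o1 y * H o0 o2 y * H o0 o2 y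
    - H o2 o2 y * H o0 o1 y * H o0 o1 y
    = f y (u y) * (H o0 o0 y + H o1 o1 y + H o2 o2 y).
  by move=> By; have [E _] := Heq y By; move: E; rewrite (detQ _ By) (trQ y).
have trB y : B y -> H o0 o0 y + H o1 o1 y + H o2 o2 y != 0.
  by move=> By; have [_ E] := Heq y By; move: E; rewrite (trQ y).
have [E1 [g2 dg2 E2]] := @differentiated_equation R 3 B u (fun y => f y (u y)) _ x0
  (e o0) (e o1) (e o2) Bo Cu xB (fun t It => is_derive_rhs Cf C2 It) eqB trB H01 H02 H12.
change ('D_(e o0) ('D_(e o0) u) x0) with (H o0 o0 x0) in E1, E2.
change ('D_(e o1) ('D_(e o1) u) x0) with (H o1 o1 x0) in E1, E2.
change ('D_(e o2) ('D_(e o2) u) x0) with (H o2 o2 x0) in E1, E2.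
rewrite H00 H11 H22 in E1 E2.
(* phi >= ln lambda_1 >= ln u_11 near x0, with equality at x0. *)
case: touch => -[V [Vo Vx Cphi]] phi_ge phi_eq.
have H00_gt0 : 0 < H o0 o0 x0 by rewrite H00; apply: lt_le_trans l1_ge1.
have lnH : \forall y \near x0, ln (H o0 o0 y) <= phi y.
  have HB : \forall y \near x0, B y by exact: open_nbhs_nbhs.
  have cH : H o0 o0 @ x0 --> H o0 o0 x0 by exact: (Ck_continuous (CH o0 o0) xB).
  have Hp : \forall y \near x0, 0 < H o0 o0 y := cvgr_gt _ cH _ H00_gt0.
  near=> y; have By : B y by near: y; exact: HB.
  have Hy : 0 < H o0 o0 y by near: y; exact: Hp.
  have by_phi : b y <= phi y by near: y; exact: phi_ge.
  apply: le_trans by_phi.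
  have vv : (e o0 *m (e o0)^T) 0 0 = 1 by rewrite row_orthonormal // mxE eqxx.
  have ry : H o0 o0 y <= lambda 0 (hess 1%:M u y).
    have -> : H o0 o0 y = (e o0 *m hess 1%:M u y *m (e o0)^T) 0 0.
      exact: (derive2E (e o0) (e o0) Bo C2 By).
    by have := rayleigh (e o0) (hsym y By); rewrite vv mulr1.
  have lam0 : 0 < lambda 0 (hess 1%:M u y) := lt_le_trans Hy ry.
  exact: ln_le Hy lam0 ry.
have phiE : phi x0 = ln (H o0 o0 x0) by rewrite phi_eq H00.
have T i := touches_above_ln (e i) Bo (CH o0 o0) xB H00_gt0 Vo Cphi Vx lnH phiE.
have [T0 T0'] := T o0; have [T1 T1'] := T o1; have [T2 T2'] := T o2.
rewrite H00 in T0 T0' T1 T1' T2 T2'.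
have J := jacobi_algebra l10 l21 l2_gt0 lll E1 E2 T0' T1' T2'.
have ffx : l 0%N * l 1%N * l 2%N / s = fx by rewrite lll mulfK ?gt_eqF.
have [F0 F1 F2] : [/\ Fdiag (hess Q u x0) o0 = (l 1%N * l 2%N - fx) / s,
    Fdiag (hess Q u x0) o1 = (l 0%N * l 2%N - fx) / s
  & Fdiag (hess Q u x0) o2 = (l 0%N * l 1%N - fx) / s].
  have dn : (\row_i lambda i A) 0 o0 + (\row_i lambda i A) 0 o1
      + (\row_i lambda i A) 0 o2 != 0 :> R by rewrite !mxE gt_eqF.
  by rewrite Hdiag -ffx; have := Fdiag_diag3 dn; rewrite !mxE.
have gphi i : grad Q phi x0 0 i = 'D_(e i) phi x0 by rewrite mxE.
have hphi i : hess Q phi x0 i i = 'D_(e i) ('D_(e i) phi) x0 by rewrite mxE.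
rewrite !sum3 !gphi !hphi F0 F1 F2 T0 T1 T2.
have [minf_gt0 minf_le] : 0 < minf /\ (forall p, K p -> minf <= joint f p).
  have KU p : K p -> cyl B setT p.
    by move=> [pr _]; split=> //; exact: eball_ecball r910 pr.
  apply: compact_inf_gt0; first exact: cyl_compact.
  - by exists (row_mx x0 (const_mx (u x0))); exact: (graph_in_cyl r910 C2 uM xS).
  - by move=> p /KU Up; have [Cf1 _] := Cf; exact: (Ck_continuous Cf1 Up).
  - by move=> p /KU [Bp _]; exact: fpos.
have minf_fx : minf <= fx.
  rewrite /fx -(joint_graph f u x0); apply: minf_le.
  exact: (graph_in_cyl r910 C2 uM xS).
have bound1 : `|rhs_derive f u x0 (e o0) 0| <=
    4 * normC11 K (joint f) * (1 + normC01 (ecball 9) u).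
  exact: (rhs_derive_le r910 Cf C2 uM x0r (e1 o0)).
have bound2 : - (4 * normC11 K (joint f) * (4 + normC01 (ecball 9) u)
    * (1 + normC01 (ecball 9) u)) - 4 * normC11 K (joint f) * l 0%N <= g2.
  have uqq : 0 <= H o0 o0 x0 by exact: ltW.
  rewrite -H00; exact: (rhs_derive2_ge r910 Cf C2 uM x0r (e1 o0) dg2 uqq).
have low := jacobi_constant_ge L0 N0 minf_gt0 minf_fx l1_ge1 bound1 bound2.
exact: combine (le_trans low J).
Unshelve. all: by end_near. Qed.
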